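(* Let $M$ be a two-dimensional closed Riemannian manifold with a topologically transitive Filippov system $Z$ having a finite number of tangency points and no pseudo-equilibrium points. If the sliding region or the escaping region is non-empty (i.e. $\Sigma^{ss}\cup\Sigma^{us}\neq\emptyset$), then $Z$ has positive topological entropy: $h(Z)>0$.
   Context: Setting. $M$ is a 2-dimensional closed $C^k$ Riemannian manifold ($k$ sufficiently large) with induced distance $d$. The switching manifold is $\Sigma=\bigcup_{i=1}^n\Sigma_i$, a union of pairwise disjoint smooth curves $\Sigma_i=h_i^{-1}(0)$, where $h_i:M\to\mathbb{R}$ is smooth with $0$ as a regular value. $\Sigma$ splits $M$ into $n+1$ disjoint regions $R_1,\dots,R_{n+1}$, and $\Sigma$ is contained in the boundary of the regions. For each $j$ a $C^r$ vector field $X_j$ ($1\le r\le k$) is given. For each $i$, $Y_{i_1}$ (resp. $Y_{i_2}$) denotes the one of the fields $X_j$ associated with the side $h_i>0$ (resp. $h_i<0$) of $\Sigma_i$; write $Yh=dh(Y)$. The Filippov system $Z$ is: $Z=X_j$ on $R_j$, and on $\Sigma_i$ (Filippov's convention) $Z=\frac{(Y_{i_2}h_i)Y_{i_1}-(Y_{i_1}h_i)Y_{i_2}}{Y_{i_2}h_i-Y_{i_1}h_i}$, which is tangent to $\Sigma_i$ and is called the sliding vector field where it is used. Points $x\in\Sigma_i$ are: crossing points ($x\in\Sigma^c$) if both fields point to the same side, $Y_{i_1}h_i(x)\,Y_{i_2}h_i(x)>0$; sliding points ($x\in\Sigma^{ss}$) if both fields point towards $\Sigma$, $Y_{i_1}h_i(x)<0<Y_{i_2}h_i(x)$;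 escaping points ($x\in\Sigma^{us}$) if both fields point away from $\Sigma$, $Y_{i_2}h_i(x)<0<Y_{i_1}h_i(x)$; tangency points ($x\in\Sigma^t$) if $Y_{i_1}h_i(x)\,Y_{i_2}h_i(x)=0$. A pseudo-equilibrium is a point $p\in\Sigma^{ss}\cup\Sigma^{us}$ with $Z(p)=0$. A Filippov orbit is a (continuous) map $\gamma:\mathbb{R}\to M$ such that: outside $\Sigma$ it is locally a trajectory of the smooth field $X_j$; at a crossing point it crosses $\Sigma$; when it touches $\Sigma^{ss}\cup\Sigma^{us}$ it follows the sliding vector field, except that in an escaping region it may exit (to either side) at any arbitrary moment (symmetrically, a sliding region may be entered from either side at any point). At tangency points, where uniqueness may fail, an orbit may continue along any of the trajectories departing from the point. $Z$ is topologically transitive if for any two non-empty open sets $U,V\subset M$ there is a Filippov orbit from a point of $U$ to a point of $V$. Orbit space and entropy. The orbit space $\widetilde M$ is the set of all Filippov orbits of $Z$, with the metric $\widetilde d_{\sup}(\gamma_0,\gamma_1)=\sum_{i\in\mathbb{Z}}2^{-|i|}\sup_{i\le t<i+1}d(\gamma_0(t),\gamma_1(t))$, and carries the continuous flow $\widetilde\Phi^t(\gamma)(s)=\gamma(t+s)$. For a continuous map $f:K\to K$ of a compact metric space $(K,d_K)$, $g^n(f,\varepsilon)$ is the smallest cardinality of a set $E\subseteq K$ such that for every $x\in K$ there is $a\in E$ with $d_K(f^i(x),f^i(a))<\varepsilon$ for $0\le i<n$, and $h(f)=\lim_{\varepsilon\to0}\limsup_{n\to\infty}\frac1n\log g^n(f,\varepsilon)$.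 The orbit space is assumed to be compact. The topological entropy of $Z$ is $h(Z):=h(\widetilde\Phi^1)$, the entropy of the time-1 map on $\widetilde M$. *)

(* Defs.v *)
From HB Require Import structures.
From mathcomp Require Import all_boot all_order all_algebra.
From mathcomp Require Import all_classical all_reals all_analysis.

Set Implicit Arguments.
Unset Strict Implicit.
Unset Printing Implicit Defensive.

Import Order.TTheory GRing.Theory Num.Theory.
Import numFieldNormedType.Exports.

Local Open Scope classical_set_scope.
Local Open Scope ring_scope.

Fixpoint Ck (R : realType) (V W : normedModType R) (k : nat)
    (U : set V) (f : V -> W) : Prop :=
  if k is k'.+1 then
    (forall x, U x -> differentiable f x) /\ (forall v, Ck k' U ('D_v f))
  else forall x, U x -> {for x, continuous f}.

(** [cmap] and [cinv] are total functions; only their restrictions to [cdom]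
    and to [cmap @` cdom] matter. *)
Record chart (R : realType) (M : topologicalType) := Chart {
  cdom : set M;
  cmap : M -> 'rV[R]_2;
  cinv : 'rV[R]_2 -> M;
  cdom_open : open cdom;
  cimg_open : open (cmap @` cdom);
  cmapK : forall x, cdom x -> cinv (cmap x) = x;
  cmap_continuous : forall x, cdom x -> {for x, continuous cmap};
  cinv_continuous : forall u, (cmap @` cdom) u -> {for u, continuous cinv} }.

Record surface (R : realType) (k : nat) (M : topologicalType) := Surface {
  atlas : set (chart R M);
  chart_at : M -> chart R M;
  chart_at_atlas : forall x, atlas (chart_at x);
  chart_at_dom : forall x, cdom (chart_at x) x;
  transition_Ck : forall c1 c2, atlas c1 -> atlas c2 ->
    Ck k (cmap c1 @` (cdom c1 `&` cdom c2)) (cmap c2 \o cinv c1) }.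

(** A tangent vector at [x] is represented by its coordinates in the chart
    [chart_at x]; [tcoord] and [tvect] translate these coordinates to and from
    the coordinates in another chart around [x]. *)
Section tangent.
Context (R : realType) (k : nat) (M : topologicalType) (S : surface R k M).

Definition tcoord (c : chart R M) (x : M) (v : 'rV[R]_2) : 'rV[R]_2 :=
  'd (cmap c \o cinv (chart_at S x)) (cmap (chart_at S x) x) v.

Definition tvect (c : chart R M) (x : M) (v : 'rV[R]_2) : 'rV[R]_2 :=
  'd (cmap (chart_at S x) \o cinv c) (cmap c x) v.

Definition Ck_function (m : nat) (f : M -> R) : Prop :=
  forall c, atlas S c -> Ck m (cmap c @` cdom c) (f \o cinv c).

Definition Ck_vector_field (m : nat) (X : M -> 'rV[R]_2) : Prop :=
  forall c, atlas S c -> Ck m (cmap c @` cdom c)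
    (fun u => tcoord c (cinv c u) (X (cinv c u))).

Definition dfun (f : M -> R) (x : M) (v : 'rV[R]_2) : R :=
  'd (f \o cinv (chart_at S x)) (cmap (chart_at S x) x) v.

(** The velocity at time 0 of the curve [c]: two-sided for [F = 0^'], one-sided
    for [F = 0^'+] and [F = 0^'-]. *)
Definition velocity (F : set_system R) (c : R -> M) (v : 'rV[R]_2) : Prop :=
  (fun s => s^-1 *: (cmap (chart_at S (c 0)) (c s)
                     - cmap (chart_at S (c 0)) (c 0))) @ F --> v.

(** [g x] is the Gram matrix, in [chart_at x], of the inner product on the
    tangent space at [x]. *)
Definition inner (g : M -> 'M[R]_2) (x : M) (v w : 'rV[R]_2) : R :=
  (v *m g x *m w^T) 0 0.

Definition C1_curve (c : R -> M) : Prop :=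
  forall t : R, 0 <= t <= 1 -> {for t, continuous c} /\
    forall e, atlas S e -> cdom e (c t) ->
      derivable (cmap e \o c) t 1 /\
      {for t, continuous (derive1 (cmap e \o c))}.

Definition speed (g : M -> 'M[R]_2) (c : R -> M) (t : R) : R :=
  let v := derive1 (cmap (chart_at S (c t)) \o c) t in
  Num.sqrt (inner g (c t) v v).

Definition length (g : M -> 'M[R]_2) (c : R -> M) : \bar R :=
  (\int[@lebesgue_measure R]_(t in `[0%R, 1%R]) (speed g c t)%:E)%E.

(** [path_length g x y l]: some piecewise C^1 path from [x] to [y] has length
    [l]. *)
Inductive path_length (g : M -> 'M[R]_2) : M -> M -> \bar R -> Prop :=
| path_nil x : path_length g x x 0%E
| path_cons c y l : C1_curve c -> path_length g (c 1) y l ->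
    path_length g (c 0) y (length g c + l)%E.

End tangent.

(** A metric of a C^k surface has at most class C^(k-1), its coefficients being
    transformed by the derivatives of the transition maps. The identity
    [mdist_inf] makes [M] connected, the infimum of the empty set being +oo. *)
Record closed_riemannian_surface (R : realType) (k : nat) (M : metricType R) :=
  ClosedRiemannianSurface {
  charts :> surface R k M;
  gram : M -> 'M[R]_2;
  gram_sym : forall x, (gram x)^T = gram x;
  gram_pos : forall x v, v != 0 -> 0 < inner gram x v v;
  gram_Ck : forall c, atlas charts c -> forall v w,
    Ck k.-1 (cmap c @` cdom c)
      (fun u => inner gram (cinv c u) (tvect charts c (cinv c u) v)
                                      (tvect charts c (cinv c u) w));
  mdist_inf : forall x y : M,
    (mdist x y)%:E = ereal_inf [set l | path_length charts gram x y l];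
  surface_compact : compact [set: M] }.

Definition switching_curve (R : realType) (M : Type) (n : nat)
  (h : 'I_n -> M -> R) (i : 'I_n) : set M := [set x | h i x = 0].

Definition switching_set (R : realType) (M : Type) (n : nat)
  (h : 'I_n -> M -> R) : set M := \bigcup_i switching_curve h i.

(** [pos_side i] and [neg_side i] are the indices of the regions (and fields)
    adjacent to the i-th curve on its sides [h i > 0] and [h i < 0]. *)
Record filippov_system (R : realType) (k r n : nat) (M : metricType R)
    (S : closed_riemannian_surface k M) := FilippovSystem {
  hfun : 'I_n -> M -> R;
  hfun_Ck : forall i, Ck_function S k (hfun i);
  hfun_regular : forall i x, switching_curve hfun i x ->
    exists v, dfun S (hfun i) x v != 0;
  curves_disjoint : forall i j, i != j ->
    switching_curve hfun i `&` switching_curve hfun j = set0;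
  region : 'I_n.+1 -> set M;
  region_open : forall j, open (region j);
  region_connected : forall j, connected (region j);
  region_nonempty : forall j, region j !=set0;
  region_disjoint : forall i j, i != j -> region i `&` region j = set0;
  region_cover : \bigcup_j region j = ~` switching_set hfun;
  switching_boundary : switching_set hfun `<=`
    \bigcup_j (closure (region j) `\` interior (region j));
  pos_side : 'I_n -> 'I_n.+1;
  neg_side : 'I_n -> 'I_n.+1;
  sides : forall i x, switching_curve hfun i x -> \forall y \near x,
    (0 < hfun i y -> region (pos_side i) y) /\
    (hfun i y < 0 -> region (neg_side i) y);
  field : 'I_n.+1 -> M -> 'rV[R]_2;
  field_Ck : forall j, Ck_vector_field S r (field j) }.

Section filippov.
Context (R : realType) (k r n : nat) (M : metricType R).
Context (S : closed_riemannian_surface k M) (Z : filippov_system r n S).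

Definition Y1 (i : 'I_n) : M -> 'rV[R]_2 := field Z (pos_side Z i).
Definition Y2 (i : 'I_n) : M -> 'rV[R]_2 := field Z (neg_side Z i).
Definition Y1h (i : 'I_n) (x : M) : R := dfun S (hfun Z i) x (Y1 i x).
Definition Y2h (i : 'I_n) (x : M) : R := dfun S (hfun Z i) x (Y2 i x).

Definition crossing (i : 'I_n) : set M :=
  [set x | hfun Z i x = 0 /\ 0 < Y1h i x * Y2h i x].
Definition sliding (i : 'I_n) : set M :=
  [set x | hfun Z i x = 0 /\ Y1h i x < 0 < Y2h i x].
Definition escaping (i : 'I_n) : set M :=
  [set x | hfun Z i x = 0 /\ Y2h i x < 0 < Y1h i x].
Definition tangency (i : 'I_n) : set M :=
  [set x | hfun Z i x = 0 /\ Y1h i x * Y2h i x = 0].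

(** Only used on sliding and escaping points, where the denominator is not
    0. *)
Definition sliding_field (i : 'I_n) (x : M) : 'rV[R]_2 :=
  (Y2h i x - Y1h i x)^-1 *: (Y2h i x *: Y1 i x - Y1h i x *: Y2 i x).

Definition pseudo_equilibrium (x : M) : Prop :=
  exists i, (sliding i `|` escaping i) x /\ sliding_field i x = 0.

(** The trajectories departing from a tangency point: those of the two adjacent
    fields in the closure of their side, and those that slide or escape along
    the curve. In the last case the velocity is prescribed by [local_orbit] at
    later times. *)
Definition departs (i : 'I_n) (c : R -> M) : Prop :=
  exists2 e : R, 0 < e &
    [\/ forall s, 0 <= s < e -> 0 <= hfun Z i (c s) /\
          velocity S 0^'+ (fun u => c (s + u)) (Y1 i (c s)),
        forall s, 0 <= s < e -> hfun Z i (c s) <= 0 /\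
          velocity S 0^'+ (fun u => c (s + u)) (Y2 i (c s))
      | forall s, 0 < s < e -> (sliding i `|` escaping i) (c s)].

(** [local_orbit c]: the curve [c] obeys the rules of [Z] at time 0. An orbit
    may come to a sliding point from either side but then has to slide, and it
    may leave an escaping point on either side but has to come from the escaping
    region. *)
Definition local_orbit (c : R -> M) : Prop :=
  (forall j, region Z j (c 0) -> velocity S 0^' c (field Z j (c 0))) /\
  forall i,
    [/\ crossing i (c 0) -> \forall s \near 0^'+,
          0 < Y1h i (c 0) * hfun Z i (c s) /\
          Y1h i (c 0) * hfun Z i (c (- s)) < 0,
        sliding i (c 0) ->
          (\forall s \near 0^'+, sliding i (c s)) /\
          velocity S 0^'+ c (sliding_field i (c 0)),
        escaping i (c 0) ->
          (\forall s \near 0^'-, escaping i (c s)) /\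
          velocity S 0^'- c (sliding_field i (c 0))
      & tangency i (c 0) -> departs i c].

Definition filippov_orbit (c : R -> M) : Prop :=
  continuous c /\ forall t, local_orbit (fun s => c (t + s)).

Definition transitive_system : Prop :=
  forall U V : set M, open U -> open V -> U !=set0 -> V !=set0 ->
    exists c, filippov_orbit c /\ exists t, [/\ 0 <= t, U (c 0) & V (c t)].

End filippov.

Definition dist_term (R : realType) (M : metricType R) (c0 c1 : R -> M)
    (i : int) : R :=
  2 ^- `|i|%N *
    sup [set mdist (c0 t) (c1 t) | t in [set t : R | i%:~R <= t < (i + 1)%:~R]].

Definition dist_sup (R : realType) (M : metricType R) (c0 c1 : R -> M) : R :=
  fine (\esum_(i in [set: int]) (dist_term c0 c1 i)%:E)%E.

Definition orbit_space (R : realType) (k r n : nat) (M : metricType R)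
  (S : closed_riemannian_surface k M) (Z : filippov_system r n S) : Type :=
  {c : R -> M | filippov_orbit Z c}.

Section dist_sup_theory.
Context (R : realType) (M : metricType R).
Hypothesis compactM : compact [set: M].

Lemma mdist_bounded : exists2 D : R, 0 <= D & forall x y : M, mdist x y <= D.
Proof.
have [[x0]|noM] := pselect (inhabited M); last first.
  by exists 0 => // x; case: noM.
have : \forall N \near \oo, forall x : M, [set: M] x -> mdist x0 x < N%:R.
  apply: (compact_near_coveringP _).1 compactM _ _ (fun N x => mdist x0 x < N%:R) _ _.
  move=> x _; have b := @archi_boundP R _ (mdist_ge0 x0 x).
  exists (ball x 1, [set N | (Num.bound (mdist x0 x)).+1 <= N]%N).
    by split; [exact: nbhsx_ballx|exact: nbhs_infty_ge].
  move=> [y N] /= []; rewrite ballEmdist/= => xy bN.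
  rewrite (le_lt_trans (metric_triangle _ x _))//.
  apply: (@lt_le_trans _ _ (Num.bound (mdist x0 x)).+1%:R).
    by rewrite -natr1 ltrD.
  by rewrite ler_nat.
move=> [N _ /(_ N (leqnn N)) b]; exists (2 * N%:R) => // x y.
rewrite (le_trans (metric_triangle _ x0 _))// mulr2n mulrDl !mul1r lerD//.
  by rewrite metric_sym ltW// b.
by rewrite ltW// b.
Qed.

Lemma esum_weights (D : R) : 0 <= D ->
  (\esum_(i in [set: int]) (2 ^- `|i|%N * D)%:E < +oo)%E.
Proof.
move=> D0.
have le2 (e : nat -> nat) : (forall n, n <= e n)%N ->
    (\sum_(0 <= i <oo) (2 ^- (e i) * D)%:E <= (2 * D)%:E)%E.
  move=> ne; apply: lime_le.
    by apply: is_cvg_nneseries => n _ _; rewrite lee_fin mulr_ge0.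
  apply: nearW => n; rewrite sumEFin lee_fin -mulr_suml.
  apply: (ler_wpM2r D0).
  apply: (@le_trans _ _ (\sum_(0 <= i < n) (2^-1 : R) ^+ i)).
    apply: ler_sum_nat => i _; rewrite exprVn lef_pV2 ?posrE ?exprn_gt0//.
    by rewrite ler_weXn2l// ler1n.
  have := @geometric_seriesE R 1 2^-1.
  have h : (2^-1 : R) != 1 by rewrite lt_eqF// invf_lt1// ltr1n.
  move=> /(_ h)/(congr1 (@^~ n)); rewrite /series/=.
  under eq_bigr do rewrite mul1r.
  move=> ->; rewrite mul1r.
  have -> : 1 - 2^-1 = 2^-1 :> R by rewrite {1}(splitr 1) mul1r addrK.
  rewrite invrK -[leRHS]mul1r; apply: ler_wpM2r => //.
rewrite (esumID (range Posz)); last first.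
  by move=> i _; rewrite lee_fin mulr_ge0// invr_ge0 exprn_ge0.
have -> : setT `&` ~` range Posz = range Negz.
  rewrite setTI; apply/seteqP; split => [[n|n]/=|_ [n _ <-]].
  - by move=> /(_ (ex_intro2 _ _ n I erefl)).
  - by exists n.
  - by case.
rewrite setTI !esum_image//; last 2 first.
- by move=> ? ? _ _ [].
- by move=> ? ? _ _ [].
rewrite -!nneseries_esumT; try by
  move=> n; rewrite lee_fin mulr_ge0// invr_ge0 exprn_ge0.
apply: lte_add_pinfty.
  exact: le_lt_trans (le2 id (fun n => leqnn n)) (ltry _).
exact: le_lt_trans (le2 succn leqnSn) (ltry _).
Qed.

Lemma int_itv (i : int) : (i%:~R : R) <= (i%:~R : R) < ((i + 1)%:~R : R).
Proof. by rewrite lexx ltr_int ltrDl. Qed.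

Lemma mdist_le_sup (c0 c1 : R -> M) (i : int) (t : R) :
  i%:~R <= t < (i + 1)%:~R ->
  mdist (c0 t) (c1 t) <= sup [set mdist (c0 t) (c1 t) | t in
    [set t : R | i%:~R <= t < (i + 1)%:~R]].
Proof.
move=> it; apply: ub_le_sup; last by exists t.
by have [D _ DM] := mdist_bounded; exists D => _ [s _ <-].
Qed.

Lemma dist_term_ge0 (c0 c1 : R -> M) i : 0 <= dist_term c0 c1 i.
Proof.
rewrite mulr_ge0// ?invr_ge0 ?exprn_ge0//.
exact: le_trans (mdist_ge0 _ _) (mdist_le_sup c0 c1 (int_itv i)).
Qed.

Lemma dist_sup_fin (c0 c1 : R -> M) :
  (\esum_(i in [set: int]) (dist_term c0 c1 i)%:E)%E \is a fin_num.
Proof.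
rewrite ge0_fin_numE; last first.
  by apply: esum_ge0 => i _; rewrite lee_fin dist_term_ge0.
have [D D0 DM] := mdist_bounded.
apply: le_lt_trans (esum_weights D0); apply: le_esum => i _.
rewrite lee_fin; apply: ler_wpM2l; first by rewrite invr_ge0 exprn_ge0.
apply: ge_sup; last by move=> _ [t _ <-].
by exists (mdist (c0 i%:~R) (c1 i%:~R)), i%:~R => //=; exact: int_itv.
Qed.

Lemma dist_supxx (c : R -> M) : dist_sup c c = 0.
Proof.
rewrite /dist_sup esum1// => i _.
rewrite /dist_term (_ : [set _ | _ in _] = [set 0]) ?sup1 ?mulr0//.
apply/seteqP; split => [_ [t _ <-]|_ ->] /=; first by rewrite mdistxx.
by exists i%:~R; [exact: int_itv|rewrite mdistxx].
Qed.

Lemma dist_sup_eq0 (c0 c1 : R -> M) : dist_sup c0 c1 = 0 -> c0 = c1.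
Proof.
move=> d0; apply/funext => t; apply: mdist_positivity.
apply/le_anti; rewrite mdist_ge0 andbT.
have it := floor_itv t; apply: le_trans (mdist_le_sup c0 c1 it) _.
set i := Num.floor t in it *.
rewrite -(@pmulr_rle0 _ (2 ^- `|i|%N)) ?invr_gt0 ?exprn_gt0// -lee_fin.
rewrite -d0 /dist_sup fineK ?dist_sup_fin//.
apply: esum_ge; exists [set i].
  by split => //; exact: finite_set1.
by rewrite fsbig_set1.
Qed.

Lemma dist_sup_sym (c0 c1 : R -> M) : dist_sup c0 c1 = dist_sup c1 c0.
Proof.
rewrite /dist_sup; congr fine; apply: eq_esum => i _.
rewrite /dist_term.
rewrite (_ : (fun t => mdist (c0 t) _) = (fun t => mdist (c1 t) (c0 t)))//.
by apply/funext => t; rewrite metric_sym.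
Qed.

Lemma dist_sup_triangle (c1 c0 c2 : R -> M) :
  dist_sup c0 c2 <= dist_sup c0 c1 + dist_sup c1 c2.
Proof.
rewrite -lee_fin EFinD /dist_sup !fineK ?dist_sup_fin//.
rewrite -esumD; try by move=> i _; rewrite lee_fin dist_term_ge0.
apply: le_esum => i _; rewrite -EFinD lee_fin -mulrDr.
apply: ler_wpM2l; first by rewrite invr_ge0 exprn_ge0.
apply: ge_sup => [|_ [t it <-]].
  by exists (mdist (c0 i%:~R) (c2 i%:~R)), i%:~R => //=; exact: int_itv.
by rewrite (le_trans (metric_triangle _ (c1 t) _))// lerD// mdist_le_sup.
Qed.

End dist_sup_theory.

Section orbit_space.
Context (R : realType) (k r n : nat) (M : metricType R).
Context (S : closed_riemannian_surface k M) (Z : filippov_system r n S).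

HB.instance Definition _ := gen_eqMixin (orbit_space Z).
HB.instance Definition _ := gen_choiceMixin (orbit_space Z).

Let compactM : compact [set: M] := surface_compact S.

Let orbit_dist_eq0 (c0 c1 : orbit_space Z) :
  dist_sup (sval c0) (sval c1) = 0 -> c0 = c1.
Proof.
by move: c0 c1 => [c0 o0] [c1 o1] /= /(dist_sup_eq0 compactM); exact: eq_exist.
Qed.

HB.instance Definition _ := @isMetric.Build R (orbit_space Z)
  (fun c0 c1 => dist_sup (sval c0) (sval c1))
  (fun c => dist_supxx (sval c)) orbit_dist_eq0
  (fun c0 c1 => dist_sup_sym (sval c0) (sval c1))
  (fun c1 c0 c2 => dist_sup_triangle compactM (sval c1) (sval c0) (sval c2)).

Lemma filippov_orbit_shift (t : R) (c : R -> M) :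
  filippov_orbit Z c -> filippov_orbit Z (fun s => c (t + s)).
Proof.
move=> [cc co]; split => [s|s].
  apply: (@continuous_comp _ _ _ (fun s => t + s) c); last exact: cc.
  by apply: cvgD; [exact: cvg_cst|exact: cvg_id].
by under [X in local_orbit Z X]eq_fun do rewrite addrA; exact: co.
Qed.

Definition orbit_flow (t : R) (c : orbit_space Z) : orbit_space Z :=
  exist _ (fun s => sval c (t + s)) (filippov_orbit_shift t (svalP c)).

End orbit_space.

Section entropy.
Context (R : realType) (K : metricType R) (f : K -> K).

Definition spanning (m : nat) (eps : R) (E : set K) : Prop :=
  forall x, exists2 a, E a &
    forall i, (i < m)%N -> mdist (iter i f x) (iter i f a) < eps.

(** [g^m(f, eps)]; by convention 0 if no finite set is spanning, which does not
    happen when [K] is compact and [f] continuous. *)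
Definition span_number (m : nat) (eps : R) : nat :=
  xget 0%N [set p | (exists2 E, spanning m eps E & (E #= `I_p)%card) /\
    forall E q, spanning m eps E -> (E #= `I_q)%card -> (p <= q)%N].

Definition topological_entropy : \bar R :=
  lim ((fun eps => limn_esup
    (fun m => (m%:R^-1 * ln (span_number m eps)%:R)%:E)) @ (0 : R)^'+).

End entropy.

Definition filippov_entropy (R : realType) (k r n : nat) (M : metricType R)
    (S : closed_riemannian_surface k M) (Z : filippov_system r n S) : \bar R :=
  topological_entropy (@orbit_flow R k r n M S Z 1).

(* Main.v *)
From HB Require Import structures.
Require Import Defs.
From mathcomp Require Import all_boot all_order all_algebra.
From mathcomp Require Import all_classical all_reals all_analysis.
From mathcomp Require Import ring lra zify.

(** The whole argument is local at one sliding (or escaping) point x. As x is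
    not a pseudo-equilibrium, the sliding field does not vanish there, and every
    orbit starting on either side of the curve, slightly behind x with respect to
    the sliding direction, is caught by the curve and then slides through x
    itself; for an escaping point the same holds backwards in time. Travelling by
    transitivity from one side to the other, one gets two orbit segments from x
    to x, without x in between, that approach (or leave) x from different sides
    of the curve, and so are different. The rules at a sliding point constrain
    only the future of an orbit, and those at an escaping point only its past,
    so that the two loops can be concatenated at x in any order: the words of
    length N in two letters yield 2^N orbits that separate by a fixed distance
    before a time linear in N. *)

Set Implicit Arguments.
Unset Strict Implicit.
Unset Printing Implicit Defensive.
Import Order.TTheory GRing.Theory Num.Theory.
Import numFieldNormedType.Exports.
Local Open Scope classical_set_scope.
Local Open Scope ring_scope.

(** * Real analysis *)

(** An orbit is not determined by its starting point, so the capture at [x] has to be shown for all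
    orbits at once. Velocities are often known on one side only, hence the use of one-sided
    differential inequalities for two functions: the distance |h| to the curve and a coordinate q
    along the sliding direction, combined as q - A |h| and q + A |h|. These inequalities hold only
    near [x]. Compactness of the orbit space makes the orbits equicontinuous, which gives one time T
    during which every orbit starting close to [x] stays in that neighbourhood; the starting points
    form a wedge so close to [x] that T is long enough for the capture. Transitivity has to join
    opposite sides: while it is being caught, an orbit stays on its closed side, so that it cannot
    reach the other side without having been at [x]. This puts one visit to [x] before, and one
    after, a time at which the orbit is off the curve. *)

Lemma near0_right (R : realType) (P : R -> Prop) :
  (\forall s \near 0^'+, P s) <-> exists2 d : R, 0 < d & forall s, 0 < s < d -> P s.
Proof.
split.
  rewrite near_withinE => /nbhs_ballP[d /= d0 dP]; exists d => // s /andP[s0 sd].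
  by apply: dP => //; rewrite /ball/= sub0r normrN gtr0_norm.
move=> [d d0 dP]; rewrite near_withinE; apply/nbhs_ballP; exists d => //= s.
rewrite /ball/= sub0r normrN => sd s0; apply: dP.
by rewrite s0/= (le_lt_trans (ler_norm s)).
Qed.

(** The supremum of the times up to which [f] stays above [f a] inherits the bound by continuity,
    and the condition on the right carries it further unless it is [b]. Bounds for a short while
    after each time are all that one-sided velocities provide. *)
Lemma right_dini_le (R : realType) (f : R -> R) (a b : R) : a <= b ->
  (forall t, a <= t <= b -> {for t, continuous f}) ->
  (forall t, a <= t < b -> \forall s \near 0^'+, f t <= f (t + s)) ->
  f a <= f b.
Proof.
move=> ab fc fD.
pose E := [set t | a <= t <= b /\ forall s, a <= s <= t -> f a <= f s].
have Ea : E a by split => [|s]; [rewrite lexx|move=> /le_anti <-].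
have hsE : has_sup E by split; [exists a|exists b => t [/andP[]]].
have tb : sup E <= b by apply: ge_sup => [|t [/andP[]]//]; exists a.
have at_ : a <= sup E by apply: ub_le_sup => //; case: hsE.
have lt_sup s : a <= s < sup E -> f a <= f s.
  move=> /andP[as_ st]; have [t [/andP[_ _] Et] st'] := sup_adherent (ltac:(rewrite subr_gt0; exact: st) : 0 < sup E - s) hsE.
  by apply: Et; rewrite as_ ltW//; move: st'; rewrite subKr.
have fsup : f a <= f (sup E).
  rewrite leNgt; apply/negP => fl.
  have /fc/cvgr_lt /(_ _ fl) : a <= sup E <= b by rewrite at_ tb.
  move=> /nbhs_ballP[d /= d0 dP].
  have asup : a < sup E.
    by rewrite lt_neqAle at_ andbT; apply: contraTneq fl => <-; rewrite ltxx.
  pose s := Num.max a (sup E - d / 2).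
  have ss : a <= s < sup E.
    by rewrite /s le_max lexx/= gt_max asup/= gtrBl divr_gt0.
  suff sd : ball (sup E) d s by have := dP s sd; rewrite /= ltNge lt_sup.
  rewrite /ball/= ger0_norm ?subr_ge0 ?ltW//; last by case/andP: ss.
  rewrite /s ltrBlDr -ltrBlDl lt_max ltrD2l ltrN2 gtr_pMr// invf_lt1 ?ltr1n//.
  by rewrite orbT.
move: tb; rewrite le_eqVlt => /predU1P[<-//|tb].
have /fD/near0_right[d d0 dP] : a <= sup E < b by rewrite at_ tb.
pose t := Num.min b (sup E + d / 2).
have st : sup E < t by rewrite /t lt_min tb ltrDl divr_gt0.
suff /(ub_le_sup (proj2 hsE)) : E t by rewrite leNgt st.
split; first by rewrite (le_trans at_ (ltW st))/= ge_min lexx.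
move=> s /andP[as_ st']; have [ss|ss|->//] := ltgtP s (sup E).
  by apply: lt_sup; rewrite as_.
apply: le_trans fsup _; rewrite -(subrKC (sup E) s); apply: dP.
rewrite subr_gt0 ss/= ltrBlDl; apply: le_lt_trans st' _.
by rewrite /t gt_min ltrD2l gtr_pMr// invf_lt1 ?ltr1n// orbT.
Qed.

Lemma within_itv_continuous (R : realType) (f : R -> R) (a b : R) :
  (forall t, a <= t <= b -> {for t, continuous f}) ->
  {within `[a, b], continuous f}.
Proof.
move=> fc; apply: continuous_in_subspaceT => t; rewrite inE/= in_itv/=.
exact: fc.
Qed.

(** [p] is the distance to the curve and [q] the position along it, with the
    target at 0. With [A] large, [q - A |p|] increases all the time, and
    [q + A |p|] decreases off the curve. So when the former vanishes [p] must
    vanish too, as otherwise the latter would still be negative. *)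
Lemma reach_origin (R : realType) (p q : R -> R) (A eta T : R) :
  0 <= A -> 0 <= T ->
  (forall t, 0 <= t <= T -> {for t, continuous p}) ->
  (forall t, 0 <= t <= T -> {for t, continuous q}) ->
  (forall t, 0 <= t < T -> \forall s \near 0^'+, `|p (t + s)| <= `|p t|) ->
  (forall t, 0 <= t < T -> \forall s \near 0^'+,
    q t - A * `|p t| + eta * s <= q (t + s) - A * `|p (t + s)|) ->
  (forall t, 0 <= t < T -> p t != 0 -> \forall s \near 0^'+,
    q (t + s) + A * `|p (t + s)| <= q t + A * `|p t|) ->
  q 0 + A * `|p 0| < 0 -> 0 <= q 0 - A * `|p 0| + eta * T ->
  exists tau, [/\ 0 < tau <= T, p tau = 0, q tau = 0 &
    forall s, 0 <= s <= tau -> 0 <= p 0 * p s].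
Proof.
move=> A0 T0 pc qc pD fD gD g0 fT0.
have Apc t : 0 <= t <= T -> {for t, continuous (fun t => A * `|p t|)}.
  by move=> tT; apply: cvgMr; apply: cvg_norm; exact: pc.
pose f t := q t - A * `|p t|.
have fc t : 0 <= t <= T -> {for t, continuous f}.
  by move=> tT; apply: cvgB; [exact: qc|exact: Apc].
have fT : 0 <= f T.
  apply: le_trans fT0 _; rewrite -lerBrDr -/(f 0).
  have := @right_dini_le R (fun t => f t - eta * t) 0 T T0.
  rewrite mulr0 subr0; apply.
    move=> t tT; apply: cvgB; first exact: fc.
    by apply: cvgMr; exact: cvg_id.
  move=> t tT; have := fD _ tT; apply: filterS => s.
  rewrite /f; lra.
have p_mono s t : 0 <= s <= t -> t <= T -> `|p t| <= `|p s|.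
  move=> /andP[s0 st] tT; rewrite -lerN2.
  apply: (@right_dini_le R (fun t => - `|p t|) s t st).
    move=> r /andP[sr rt]; apply: cvgN; apply: cvg_norm; apply: pc.
    by rewrite (le_trans s0 sr) (le_trans rt tT).
  move=> r /andP[sr rt]; have /pD : 0 <= r < T.
    by rewrite (le_trans s0 sr) (lt_le_trans rt tT).
  by apply: filterS => u; rewrite lerN2.
have f0 : f 0 <= 0.
  have := mulr_ge0 A0 (normr_ge0 (p 0)); rewrite /f; lra.
have [tau] : exists2 tau, tau \in `[0, T] & f tau = 0.
  apply: IVT => //; first exact: within_itv_continuous.
  by rewrite ge_min f0/= le_max fT orbT.
rewrite in_itv/= => /andP[tau0 tauT] ftau.
have ptau : p tau = 0.
  apply/eqP/negPn/negP => ptau.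
  suff : q tau + A * `|p tau| <= q 0 + A * `|p 0|.
    by have := mulr_ge0 A0 (normr_ge0 (p tau)); move: ftau; rewrite /f; lra.
  rewrite -lerN2.
  apply: (@right_dini_le R (fun t => - (q t + A * `|p t|)) 0 tau tau0).
    move=> r /andP[r0 rt]; apply: cvgN.
    have rT : 0 <= r <= T by rewrite r0 (le_trans rt).
    by apply: cvgD; [exact: qc|exact: Apc].
  move=> r /andP[r0 rt]; have /gD : 0 <= r < T by rewrite r0 (lt_le_trans rt).
  have -> : p r != 0.
    apply: contra ptau => /eqP pr.
    by rewrite -normr_le0 (le_trans (@p_mono r _ _ tauT))// ?pr ?normr0// r0 ltW.
  by move=> /(_ isT); apply: filterS => u; rewrite lerN2.
have qtau : q tau = 0 by move: ftau; rewrite /f ptau normr0 mulr0 subr0.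
exists tau; split => //.
  rewrite tauT andbT lt_neqAle tau0 andbT; apply/eqP => t0.
  by move: g0; rewrite [X in p X]t0 [X in q X]t0 ptau qtau normr0 mulr0 addr0 ltxx.
(* A change of sign before [tau] needs a zero of [p], and from a zero on [p] remains zero because
   its absolute value does not increase. *)
move=> s /andP[s0 st]; rewrite leNgt; apply/negP => ps.
have sT : s <= T := le_trans st tauT.
have [r] : exists2 r, r \in `[0, s] & p r = 0.
  apply: IVT => //.
    apply: within_itv_continuous => r /andP[r0 rs]; apply: pc.
    by rewrite r0 (le_trans rs).
  have [p0|p0|p0] := ltgtP (p 0) 0.
  - have p1 : 0 <= p s by rewrite ltW// -(nmulr_rlt0 _ p0).
    by rewrite ge_min le_max (ltW p0) p1 orbT.
  - have p1 : p s <= 0 by rewrite ltW// -(pmulr_rlt0 _ p0).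
    by rewrite ge_min le_max (ltW p0) p1 orbT.
  - by move: ps; rewrite p0 mul0r ltxx.
rewrite in_itv/= => pr0 pr.
have : `|p s| <= `|p r| by exact: p_mono.
by rewrite pr normr0 normr_le0 => /eqP ps0; move: ps; rewrite ps0 mulr0 ltxx.
Qed.

(** * Differentials in charts *)

Lemma diff_eps (R : realType) (V W : normedModType R) (f : V -> W) (x : V)
    (e : R) : differentiable f x -> 0 < e ->
  \forall h \near 0, `|f (h + x) - f x - 'd f x h| <= e * `|h|.
Proof.
move=> /diff_locally /eqaddoP df e0; have := df e e0; apply: filterS => h.
by rewrite !fctE/= opprD addrA.
Qed.
Lemma eps_diff (R : realType) (V W : normedModType R) (f : V -> W) (x : V)
    (L : {linear V -> W}) : continuous L ->
  (forall e : R, 0 < e -> \forall h \near 0, `|f (h + x) - f x - L h| <= e * `|h|) ->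
  differentiable f x /\ 'd f x = L :> (V -> W).
Proof.
move=> Lc fL.
have fo : f \o shift x = cst (f x) + L +o_ 0 id.
  apply/eqaddoP => e e0; have := fL e e0; apply: filterS => h.
  by rewrite /= !fctE /= opprD addrA.
have dE := diff_unique Lc fo; split => //.
by apply/diff_locallyP; rewrite dE.
Qed.

(** Charts and their inverses are meaningful only on their domains, so a function read through two
    charts agrees with its reading through one chart only near a point; this carries the
    differential across. *)
Lemma near_diff (R : realType) (V W : normedModType R) (f g : V -> W) (x : V) :
  (\forall y \near x, f y = g y) -> differentiable f x ->
  differentiable g x /\ 'd g x = 'd f x :> (V -> W).
Proof.
move=> fg df; apply: eps_diff; first exact: diff_continuous.
move=> e e0; have := diff_eps df e0.
have : \forall h \near 0, f (h + x) = g (h + x).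
  by move: fg; rewrite (near_shift 0 x) subr0.
have := nbhs_singleton fg => fgx.
by apply: filterS2 => h -> ; rewrite fgx.
Qed.

Lemma cvg_near (T : Type) (V : topologicalType) (F : set_system T)
    (FF : Filter F) (f g : T -> V) (l : V) :
  (\forall x \near F, f x = g x) -> f @ F --> l -> g @ F --> l.
Proof. by move=> /near_eq_cvg/cvg_trans; apply. Qed.

(** Chain rule along a filter, so as to cover one-sided velocities. Convergence of the quotients
    forces [U s] to tend to [u], and keeps the first-order remainder of [f] negligible with respect
    to [s]. *)
Lemma diff_quotient (R : realType) (V : normedModType R) (f : V -> R) (u v : V)
    (F : set_system R) (FF : ProperFilter F) (U : R -> V) :
  (F --> 0) -> differentiable f u ->
  (fun s => s^-1 *: (U s - u)) @ F --> v -> (\forall s \near F, s != 0) ->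
  (fun s => s^-1 * (f (U s) - f u)) @ F --> 'd f u v.
Proof.
move=> F0 df Uv Fn0.
have U0 : (fun s => U s - u) @ F --> 0.
  rewrite -(scale0r v).
  have : (fun s => s *: (s^-1 *: (U s - u))) @ F --> 0 *: v by apply: cvgZ.
  apply: cvg_near; apply: filterS Fn0 => s s0.
  by rewrite scalerA mulfV// scale1r.
have dv : (fun s => 'd f u (s^-1 *: (U s - u))) @ F --> 'd f u v.
  by apply: (cvg_comp _ _ Uv); apply: diff_continuous.
suff r0 : (fun s => s^-1 * (f (U s) - f u) - 'd f u (s^-1 *: (U s - u))) @ F --> (0 : R).
  rewrite -['d f u v]addr0; apply: cvg_near (cvgD dv r0).
  by apply: nearW => s /=; rewrite addrC subrK.
apply/cvgr0Pnorm_le => e e0.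
have v1 : 0 < `|v| + 1 by rewrite ltr_pwDr.
have e1 : 0 < e / (`|v| + 1) by rewrite divr_gt0.
have := U0 _ (diff_eps df e1); rewrite near_map.
have : \forall s \near F, `|s^-1 *: (U s - u)| <= `|v| + 1.
  have : (fun s => `|s^-1 *: (U s - u)|) @ F --> `|v| by exact: cvg_norm.
  by move=> /cvgr_le; apply; rewrite ltrDl.
move: Fn0; apply: filterS3 => s s0 Us /=; rewrite subrK => fs.
rewrite linearZ/= -mulrBr normrM.
apply: (@le_trans _ _ (`|s^-1| * (e / (`|v| + 1) * `|U s - u|))).
  by apply: ler_wpM2l => //.
rewrite mulrCA; apply: (@le_trans _ _ (e / (`|v| + 1) * (`|v| + 1))).
  apply: ler_wpM2l; first exact: ltW.
  by move: Us; rewrite normrZ.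
by rewrite divfK// gt_eqF.
Qed.

Section charts.
Context (R : realType) (k : nat) (M : topologicalType) (S : surface R k M).
Hypothesis k0 : (0 < k)%N.
Implicit Types (c : chart R M) (x y : M).

Lemma near_cdom c x : cdom c x -> \forall y \near x, cdom c y.
Proof. by move=> cx; apply: open_nbhs_nbhs; split => //; exact: cdom_open. Qed.

Lemma near_cimg c x : cdom c x ->
  \forall u \near cmap c x, (cmap c @` cdom c) u.
Proof.
by move=> cx; apply: open_nbhs_nbhs; split; [exact: cimg_open|exists x].
Qed.

Lemma near_cinvK c x : cdom c x ->
  \forall u \near cmap c x, cmap c (cinv c u) = u.
Proof.
by move=> /near_cimg; apply: filterS => u [y cy <-]; rewrite cmapK.
Qed.

Lemma near_cinv c x (P : set M) : cdom c x -> (\forall y \near x, P y) ->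
  \forall u \near cmap c x, P (cinv c u).
Proof.
move=> cx xP.
have : cinv c @ cmap c x --> cinv c (cmap c x).
  by apply: cinv_continuous; exists x.
by rewrite cmapK//; apply.
Qed.

Lemma transition_diff c1 c2 x : atlas S c1 -> atlas S c2 ->
  cdom c1 x -> cdom c2 x -> differentiable (cmap c2 \o cinv c1) (cmap c1 x).
Proof.
move=> a1 a2 x1 x2; have := transition_Ck a1 a2; rewrite -(prednK k0) /=.
by move=> [+ _]; apply; exists x.
Qed.

(** Smoothness of [f] is only assumed in the one chart [c], so as to apply to
    the coordinates of [c] too. *)
Lemma dfun_chart c x (f : M -> R) v : atlas S c -> cdom c x ->
  differentiable (f \o cinv c) (cmap c x) ->
  differentiable (f \o cinv (chart_at S x)) (cmap (chart_at S x) x) /\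
  dfun S f x v = 'd (f \o cinv c) (cmap c x) (tcoord S c x v).
Proof.
move=> ac cx df; set e := chart_at S x.
have ae : atlas S e by exact: chart_at_atlas.
have ex : cdom e x by exact: chart_at_dom.
have dt := transition_diff ae ac ex cx.
have tx : (cmap c \o cinv e) (cmap e x) = cmap c x by rewrite /= cmapK.
rewrite -tx in df.
have [||d1 d2] := @near_diff R _ _ ((f \o cinv c) \o (cmap c \o cinv e))
  (f \o cinv e) (cmap e x).
- by have := near_cinv ex (near_cdom cx); apply: filterS => u /= cu; rewrite cmapK.
- exact: differentiable_comp.
split; first exact: d1.
have dE := congr1 (fun h : 'rV[R]_2 -> R => h v) (etrans d2 (diff_comp dt df)).
apply: (etrans dE).
exact: (congr1 (fun z => 'd (f \o cinv c) z (tcoord S c x v)) tx).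
Qed.

Lemma tcoord_chart_at x v : tcoord S (chart_at S x) x v = v.
Proof.
rewrite /tcoord; set e := chart_at S x.
have ex : cdom e x by exact: chart_at_dom.
have di : is_diff (cmap e x) (id : 'rV[R]_2 -> 'rV[R]_2) id by exact: is_diff_id.
have ie : \forall u \near cmap e x, id u = (cmap e \o cinv e) u.
  by have := near_cinvK ex; apply: filterS => u /= ->.
have [_ d2] := near_diff ie (ex_diff (is_diff_def := di)).
by apply: (etrans (congr1 (@^~ v) d2)); rewrite (diff_val (is_diff_def := di)).
Qed.

Lemma velocity_dfun c (f : M -> R) (F : set_system R) (FF : ProperFilter F)
    (g : R -> M) v : atlas S c -> cdom c (g 0) ->
  differentiable (f \o cinv c) (cmap c (g 0)) ->
  F --> 0 -> (\forall s \near F, s != 0) -> {for 0, continuous g} ->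
  velocity S F g v ->
  (fun s => s^-1 * (f (g s) - f (g 0))) @ F --> dfun S f (g 0) v.
Proof.
move=> ac cx df F0 Fn0 gc gv.
have [df' _] := dfun_chart v ac cx df.
have := diff_quotient FF F0 df' gv Fn0.
apply: cvg_near; have ex := chart_at_dom S (g 0).
have : \forall s \near F, cdom (chart_at S (g 0)) (g s).
  by apply: F0; apply: gc; exact: near_cdom.
by apply: filterS => s es; rewrite /= !cmapK.
Qed.

Lemma diff_rV2 (f : 'rV[R]_2 -> R) u v :
  'd f u v = v 0 0 * 'd f u (delta_mx 0 0) + v 0 1 * 'd f u (delta_mx 0 1).
Proof.
rewrite {1}(row_sum_delta v) !big_ord_recl big_ord0 addr0 linearD !linearZ/=.
by rewrite (_ : lift ord0 ord0 = 1)//; apply/val_inj.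
Qed.

(** The chart [chart_at y] may jump with [y], so continuity is read in the fixed chart [c], where
    the derivative is a sum of products of components of [X] and partial derivatives of [f]. *)
Lemma dfun_continuous c x (f : M -> R) (m : nat) (X : M -> 'rV[R]_2) :
  (0 < m)%N -> atlas S c -> cdom c x ->
  Ck 1 (cmap c @` cdom c) (f \o cinv c) -> Ck_vector_field S m X ->
  {for x, continuous (fun y => dfun S f y (X y))}.
Proof.
move=> m0 ac cx [df cf] /(_ c ac); rewrite -(prednK m0) => -[dX _].
set G := fun u => _ in dX.
have xi : (cmap c @` cdom c) (cmap c x) by exists x.
have Gc : {for cmap c x, continuous G}.
  by apply: differentiable_continuous; exact: dX.
pose D u := G u 0 0 * 'D_(delta_mx 0 0) (f \o cinv c) u
          + G u 0 1 * 'D_(delta_mx 0 1) (f \o cinv c) u.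
have Dc : {for cmap c x, continuous D}.
  have Gj j : {for cmap c x, continuous (fun u => G u 0 j)}.
    apply: (@continuous_comp _ _ _ G (fun M : 'rV[R]_2 => M 0 j)) => //.
    exact: coord_continuous.
  exact: (cvgD (cvgM (Gj 0) (cf (delta_mx 0 0) _ xi))
               (cvgM (Gj 1) (cf (delta_mx 0 1) _ xi))).
have : (D \o cmap c) @ x --> (D \o cmap c) x.
  exact: (@cvg_comp _ _ _ (cmap c) D _ _ _ (cmap_continuous cx) Dc).
have DE y : cdom c y -> (D \o cmap c) y = dfun S f y (X y).
  move=> cy; have yi : (cmap c @` cdom c) (cmap c y) by exists y.
  have [_ ->] := dfun_chart (X y) ac cy (df _ yi).
  rewrite diff_rV2 /D /= !deriveE; try exact: df.
  by rewrite /G cmapK.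
rewrite DE// /prop_for /continuous_at; apply: cvg_near; have := near_cdom cx; exact: filterS.
Qed.

End charts.

(** * The local picture at a sliding point *)

(** Euclidean product of chart coordinates, independent of the Riemannian metric. *)
Definition dot (R : realType) (w v : 'rV[R]_2) : R :=
  w 0 0 * v 0 0 + w 0 1 * v 0 1.

Lemma dot_is_linear (R : realType) (w : 'rV[R]_2) : linear (dot w).
Proof. by move=> a u v; rewrite -[a *: dot w u]/(a * dot w u) /dot !mxE; ring. Qed.

HB.instance Definition _ (R : realType) (w : 'rV[R]_2) :=
  GRing.isLinear.Build R 'rV[R]_2 R _ (dot w) (dot_is_linear w).

Lemma dot_continuous (R : realType) (w : 'rV[R]_2) : continuous (dot w).
Proof.
move=> u; have coo j : (fun v : 'rV[R]_2 => v 0 j) @ u --> u 0 j.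
  exact: coord_continuous.
have mul a j : (fun v : 'rV[R]_2 => a * v 0 j) @ u --> a * u 0 j.
  exact: (cvgMl_tmp (coo j)).
exact: cvgD (mul (w 0 0) 0) (mul (w 0 1) 1).
Qed.

Definition rot (R : realType) (w : 'rV[R]_2) : 'rV[R]_2 :=
  \row_j (if j == 0 then - w 0 1 else w 0 0).

Lemma dot_rot (R : realType) (w : 'rV[R]_2) : dot w (rot w) = 0.
Proof. by rewrite /dot !mxE/=; ring. Qed.

Lemma rV2P (R : realType) (u v : 'rV[R]_2) :
  u 0 0 = v 0 0 -> u 0 1 = v 0 1 -> u = v.
Proof.
move=> e0 e1; apply/rowP => j; case: j => [[|[|//]] jlt].
  by rewrite (_ : Ordinal jlt = 0)//; apply/val_inj.
by rewrite (_ : Ordinal jlt = 1)//; apply/val_inj.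
Qed.

Lemma dot_gt0 (R : realType) (w : 'rV[R]_2) : w != 0 -> 0 < dot w w.
Proof.
move=> w0; rewrite lt_neqAle /dot -!expr2 addr_ge0 ?sqr_ge0// andbT eq_sym.
apply: contra w0; rewrite paddr_eq0 ?sqr_ge0// !sqrf_eq0 => /andP[/eqP a /eqP b].
by apply/eqP/rV2P; rewrite !mxE.
Qed.

Lemma rot_decomp (R : realType) (w v : 'rV[R]_2) : w != 0 ->
  v = (dot w v / dot w w) *: w + (dot (rot w) v / dot w w) *: rot w.
Proof.
move=> /dot_gt0/lt0r_neq0 ww0.
by apply: rV2P; rewrite !mxE /dot !mxE/=; move: ww0; rewrite /dot => ww0; field.
Qed.

(** Rolle along the direction [rot a], on which [H] has a non-zero derivative. *)
Lemma graph_inj (R : realType) (H : 'rV[R]_2 -> R) (D : set 'rV[R]_2)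
    (u0 a : 'rV[R]_2) : a != 0 -> open D -> D u0 -> Ck 1 D H -> H u0 = 0 ->
  'D_(rot a) H u0 != 0 ->
  \forall u \near u0, H u = 0 -> dot a (u - u0) = 0 -> u = u0.
Proof.
move=> a0 oD Du0 [dH cH] H0 Hw.
have : \forall u \near u0, D u /\ 'D_(rot a) H u != 0.
  apply: filterI; first by apply: open_nbhs_nbhs.
  exact: (cvgr_neq0 _ (cH (rot a) _ Du0)).
move=> /nbhs_ballP[rho /= rho0 Dball].
apply/nbhs_ballP; exists rho => //= u uball Hu du.
pose v := u - u0; pose l := dot (rot a) v / dot a a.
have vE : v = l *: rot a by rewrite {1}(rot_decomp v a0) du mul0r scale0r add0r.
have [l0|l0] := eqVneq l 0.
  by apply/eqP; rewrite -subr_eq0 -/v vE l0 scale0r.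
pose g (s : R) := H (u0 + s *: v).
have inball s : 0 <= s <= 1 -> ball u0 rho (u0 + s *: v).
  move=> /andP[s0 s1]; move: uball; rewrite -ball_normE /= opprD addNKr.
  rewrite normrN normrZ ger0_norm// distrC => uball.
  by rewrite (le_lt_trans _ uball)// ler_piMl.
have gq s : (fun h : R => h^-1 *: ((g \o shift s) (h *: 1) - g s)) =
    (fun h : R => h^-1 *: ((H \o shift (u0 + s *: v)) (h *: v) - H (u0 + s *: v))).
  apply/funext => h; congr (_ *: (_ - _)); rewrite /g/=; congr H.
  by rewrite scalerDl addrCA -[h *: 1]/(h * 1) mulr1.
have gd s : 0 <= s <= 1 -> derivable g s 1 /\ 'D_1 g s = l * 'D_(rot a) H (u0 + s *: v).
  move=> s01; have [Ds _] := Dball _ (inball _ s01).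
  have ds := dH _ Ds; split.
    by rewrite /derivable gq; apply: diff_derivable.
  rewrite (_ : 'D_1 g s = 'D_v H (u0 + s *: v)); last by rewrite /derive gq.
  move: ds; set p := u0 + _ => ds.
  by rewrite !deriveE// vE linearZ.
have gc : {within `[0, 1], continuous g}.
  apply: within_itv_continuous => s s01; have [ds _] := gd _ s01.
  by apply: differentiable_continuous; apply/derivable1_diffP.
have [||s] := Rolle ltr01 _ gc.
- by move=> s; rewrite in_itv/= => /andP[s0 s1]; apply: (gd s _).1; rewrite !ltW.
- by rewrite /g scale0r addr0 scale1r /v subrKC H0 Hu.
rewrite in_itv/= => /andP[s0 s1] gs.
have s01 : 0 <= s <= 1 by rewrite !ltW.
have := (gd s s01).2; rewrite derive_val => /esym/eqP.
by rewrite mulf_eq0 (negbTE l0)/= (negbTE (Dball _ (inball _ s01)).2).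
Qed.

(** The point is [u0 + t (- a + w)] for a small [t > 0] and a multiple [w] of
    [rot a] that is small compared to [a]. *)
Lemma wedge_point (R : realType) (H : 'rV[R]_2 -> R) (u0 a : 'rV[R]_2)
    (A eps s : R) (U : set 'rV[R]_2) :
  a != 0 -> differentiable H u0 -> H u0 = 0 -> 'd H u0 a = 0 ->
  'd H u0 (rot a) != 0 -> 0 < A -> 0 < eps -> `|s| = 1 ->
  (\forall u \near u0, U u) ->
  exists u, [/\ U u, dot a (u - u0) + A * `|H u| < 0,
    - eps < dot a (u - u0) - A * `|H u| & 0 < s * H u].
Proof.
move=> a0 dH H0 Ha Hw A0 e0 s1 nU.
have aa := dot_gt0 a0.
pose m := 'd H u0 (rot a).
have m0 : 0 < `|m| by rewrite normr_gt0.
(* The factor [s * Num.sg m] puts the point on the side [s]. With this [kap] the main part of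
   [A * |H|] is a quarter of [dot a a] per unit of [b]; doubled to absorb the remainder, it is still
   only half of what is lost along [a]. *)
pose kap := dot a a / (4 * A * `|m|).
have kap0 : 0 < kap by rewrite divr_gt0// !mulr_gt0.
pose v := - a + (s * Num.sg m * kap) *: rot a.
have dv : 'd H u0 v = s * (kap * `|m|).
  rewrite /v linearD linearN linearZ/= Ha oppr0 add0r -/m.
  rewrite -[X in _ *: X]/m -[_ *: m]/(s * Num.sg m * kap * m).
  by rewrite [X in _ = _ * (_ * X)]normrEsg; ring.
have av : dot a v = - dot a a.
  by rewrite /v linearD linearN linearZ/= dot_rot scaler0 addr0.
have v1 : 0 < `|v| + 1 by rewrite ltr_pwDr.
pose eps' := kap * `|m| / 2 / (`|v| + 1).
have e'0 : 0 < eps' by rewrite !divr_gt0// mulr_gt0.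
have : \forall b \near 0^'+, [/\ U (b *: v + u0),
    `|H (b *: v + u0) - H u0 - 'd H u0 (b *: v)| <= eps' * `|b *: v|,
    b < eps / (2 * dot a a) & 0 < b].
  have bv : (fun b : R => b *: v) @ 0^'+ --> (0 : 'rV[R]_2).
    by rewrite -(scale0r v); apply: cvgZr_tmp; exact: cvg_at_right_filter.
  have h1 : \forall h \near (0 : 'rV[R]_2), U (h + u0).
    by move: nU; rewrite (near_shift 0 u0) subr0.
  have n1 := bv _ h1; have n2 := bv _ (diff_eps dH e'0).
  have n3 : \forall b \near 0^'+, b < eps / (2 * dot a a).
    by apply: nbhs_right_lt; rewrite divr_gt0// mulr_gt0.
  have n4 := @nbhs_right_gt R 0.
  near=> b; split.
  - by near: b; exact: n1.
  - by near: b; exact: n2.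
  - by near: b; exact: n3.
  - by near: b; exact: n4.
move=> /near0_right[d d0 /(_ (d / 2))].
case=> [|Ub]; first by rewrite divr_gt0//= ltr_pdivrMr// ltr_pMr// ltr1n.
set b := d / 2 in Ub *.
rewrite linearZ /= dv H0 subr0 => Hb be b0.
set u := b *: v + u0 in Ub Hb.
exists u; have du : dot a (u - u0) = - (b * dot a a).
  by rewrite /u addrK linearZ/= av -mulrN.
have Hb' : `|H u - b * (s * (kap * `|m|))| <= b * (kap * `|m| / 2).
  apply: le_trans Hb _; rewrite normrZ (gtr0_norm b0) mulrCA.
  apply: ler_wpM2l; first exact: ltW.
  rewrite /eps' mulrAC ler_pdivrMr//; apply: ler_wpM2l; last by rewrite lerDl.
  by rewrite ltW// divr_gt0// mulr_gt0.
have km : A * (kap * `|m|) = dot a a / 4.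
  by rewrite /kap; move: (lt0r_neq0 A0) (lt0r_neq0 m0) => ? ?; field; apply/andP.
have ss : s * s = 1 by rewrite -expr2 -real_normK ?num_real// s1 expr1n.
have sH : `|s * H u - b * (kap * `|m|)| <= b * (kap * `|m| / 2).
  rewrite (_ : _ - _ = s * (H u - b * (s * (kap * `|m|)))).
    by rewrite normrM s1 mul1r.
  by rewrite mulrBr; congr (_ - _); rewrite [RHS]mulrCA [s * (s * _)]mulrA ss mul1r.
have bkm : 0 < b * (kap * `|m|) by apply: mulr_gt0 => //; apply: mulr_gt0.
have aH : `|H u| = `|s * H u| by rewrite normrM s1 mul1r.
move: sH; rewrite ler_norml => /andP[l1 l2].
have sH0 : 0 < s * H u by lra.
have HA : A * `|H u| <= b * (dot a a / 2).
  rewrite aH gtr0_norm//.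
  have : A * (s * H u) <= A * (2 * (b * (kap * `|m|))) by rewrite ler_pM2l//; lra.
  have -> : A * (2 * (b * (kap * `|m|))) = 2 * b * (A * (kap * `|m|)) by ring.
  by rewrite km; lra.
have HA0 : 0 <= A * `|H u| by rewrite mulr_ge0// ltW.
have baa : 0 < b * dot a a by rewrite mulr_gt0.
have : b * dot a a < eps / 2.
  move: be; rewrite ltr_pdivlMr ?mulr_gt0//; lra.
by rewrite du; split => //; lra.
Unshelve. all: by end_near. Qed.

Section local.
Context (R : realType) (k r n : nat) (M : metricType R).
Context (S : closed_riemannian_surface k M) (Z : filippov_system r n S).
Hypotheses (k0 : (0 < k)%N) (r0 : (0 < r)%N).

(** [true] stands for sliding points followed forwards in time, [false] for
    escaping points followed backwards. *)
Definition time_sign (b : bool) : R := if b then 1 else -1.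
Definition time_side (b : bool) : set_system R := if b then 0^'+ else 0^'-.
Definition slide (b : bool) (i : 'I_n) : set M :=
  if b then sliding Z i else escaping Z i.

Lemma Ck_Ck1 (V W : normedModType R) (m : nat) (U : set V) (f : V -> W) :
  (0 < m)%N -> Ck m U f -> Ck 1 U f.
Proof.
have C0 j (g : V -> W) : Ck j U g -> Ck 0 U g.
  by case: j => // j [dg _] u Uu; apply: differentiable_continuous; exact: dg.
by case: m => // m _ [df Cf]; split=> // v; exact: C0 (Cf v).
Qed.

(** Reversing time changes the sign of both derivatives and turns escaping points into sliding ones;
    the sign [time_sign b] lets one proof treat both. *)
Lemma slideP b i y : slide b i y <->
  [/\ hfun Z i y = 0, time_sign b * Y1h Z i y < 0 & 0 < time_sign b * Y2h Z i y].
Proof.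
case: b; rewrite /slide /time_sign /= ?mul1r ?mulN1r ?oppr_lt0 ?oppr_gt0.
  by split=> [[? /andP[]]|[? ? ?]]//; split=> //; apply/andP.
by split=> [[? /andP[]]|[? ? ?]]//; split=> //; apply/andP.
Qed.

Lemma near_time_side b (P : R -> Prop) :
  (\forall s \near time_side b, P s) -> \forall s \near 0^'+, P (time_sign b * s).
Proof.
case: b => /=; first by apply: filterS => s; rewrite mul1r.
have := at_rightN (0 : R); rewrite oppr0 => -> h; rewrite near_map.
by apply: filterS h => s; rewrite mulN1r opprK.
Qed.

#[local] Instance time_side_filter b : ProperFilter (time_side b).
Proof. by case: b; rewrite /time_side; apply: _. Qed.

Lemma velocity_time_side b g v : velocity S 0^' g v -> velocity S (time_side b) g v.
Proof.
apply: cvg_trans; apply: cvg_app; case: b => P; rewrite /time_side /=.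
  by apply: (@filterS R (nbhs (0 : R))) => s sP s0; apply: sP; rewrite gt_eqF.
by apply: (@filterS R (nbhs (0 : R))) => s sP s0; apply: sP; rewrite lt_eqF.
Qed.

(** A limit of difference quotients bounds [f] on a short interval only by lines of strictly smaller
    or larger slope. *)
Lemma velocity_rate b c (f : M -> R) (g : R -> M) v :
  atlas S c -> cdom c (g 0) ->
  differentiable (f \o cinv c) (cmap c (g 0)) -> {for 0, continuous g} ->
  velocity S (time_side b) g v -> let d := time_sign b * dfun S f (g 0) v in
  (forall l, l < d -> \forall s \near 0^'+, f (g 0) + l * s <= f (g (time_sign b * s))) /\
  (forall l, d < l -> \forall s \near 0^'+, f (g (time_sign b * s)) <= f (g 0) + l * s).
Proof.
move=> ac cx df gc gv d.
have F0 : time_side b --> 0.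
  by move=> P; case: (b); rewrite /time_side; apply: cvg_within.
have Fn0 : \forall s \near time_side b, s != 0.
  case: (b); rewrite /time_side.
    by have := @nbhs_right_gt R 0; apply: filterS => s; move/lt0r_neq0.
  by have := @nbhs_left_lt R 0; apply: filterS => s; move/ltr0_neq0.
have lim := velocity_dfun k0 (time_side_filter b) ac cx df F0 Fn0 gc gv.
have q : \forall s \near 0^'+, s * (time_sign b * ((time_sign b * s)^-1 * (f (g (time_sign b * s)) - f (g 0)))) =
    f (g (time_sign b * s)) - f (g 0).
  have := @nbhs_right_gt R 0; apply: filterS => s /lt0r_neq0 s0.
  by rewrite /time_sign; case: (b); field.
have lim' : time_sign b * (s^-1 * (f (g s) - f (g 0))) @[s --> time_side b] --> d.
  by apply: cvgM; [exact: cvg_cst|exact: lim].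
split=> l ld.
  have h := cvgr_gt _ lim' _ ld; have {h} := near_time_side (h (time_side_filter b)).
  move: q (@nbhs_right_gt R 0); apply: filterS3 => s qs s0 hl.
  by rewrite -lerBrDl -qs mulrC ler_wpM2l ?ltW.
have h := cvgr_lt _ lim' _ ld; have {h} := near_time_side (h (time_side_filter b)).
move: q (@nbhs_right_gt R 0); apply: filterS3 => s qs s0 hl.
by rewrite -lerBlDl -qs [l * s]mulrC ler_wpM2l ?ltW.
Qed.

Lemma chart_continuous c x (f : M -> R) : cdom c x ->
  differentiable (f \o cinv c) (cmap c x) -> {for x, continuous f}.
Proof.
move=> cx df.
have : ((f \o cinv c) \o cmap c) @ x --> ((f \o cinv c) \o cmap c) x.
  exact: (@cvg_comp _ _ _ (cmap c) (f \o cinv c) _ _ _ (cmap_continuous cx)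
    (differentiable_continuous df)).
rewrite /= cmapK// /prop_for /continuous_at; apply: cvg_near.
by have := near_cdom cx; apply: filterS => y cy /=; rewrite cmapK.
Qed.

Lemma dfun_sliding f i x : dfun S f x (sliding_field Z i x) =
  (Y2h Z i x - Y1h Z i x)^-1 * (Y2h Z i x * dfun S f x (Y1 Z i x)
     - Y1h Z i x * dfun S f x (Y2 Z i x)).
Proof. by rewrite /sliding_field /dfun linearZ linearB !linearZ. Qed.

Definition chart_dot c (a : 'rV[R]_2) (x : M) (y : M) : R :=
  dot a (cmap c y - cmap c x).

Lemma chart_dot_diff c a x u : (cmap c @` cdom c) u ->
  differentiable (chart_dot c a x \o cinv c) u /\
  'd (chart_dot c a x \o cinv c) u = dot a :> (_ -> _).
Proof.
move=> [y cy <-]; apply: eps_diff; first exact: dot_continuous.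
move=> e e0; have := near_cinvK cy.
rewrite (near_shift 0 (cmap c y)) subr0; apply: filterS => h /= hK.
rewrite /chart_dot hK cmapK// -linearB /= opprB addrA subrK addrK.
by rewrite subrr normr0 mulr_ge0// ltW.
Qed.

Lemma chart_dot_Ck c a x : Ck 1 (cmap c @` cdom c) (chart_dot c a x \o cinv c).
Proof.
split=> [u /(chart_dot_diff a x)[]//|v u [y cy <-]].
have E : \forall u \near cmap c y, dot a v = 'D_v (chart_dot c a x \o cinv c) u.
  have := near_cimg cy; apply: filterS => w /(chart_dot_diff a x)[d dE].
  by rewrite deriveE// dE.
rewrite /prop_for /continuous_at -(nbhs_singleton E).
by apply: cvg_near E _; exact: cvg_cst.
Qed.

Lemma local_orbit0 g : filippov_orbit Z g -> local_orbit Z g.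
Proof. by move=> [_ /(_ 0)]; under eq_fun do rewrite add0r. Qed.

Lemma slide_rule b i g : local_orbit Z g -> slide b i (g 0) ->
  (\forall s \near time_side b, slide b i (g s)) /\
  velocity S (time_side b) g (sliding_field Z i (g 0)).
Proof. by move=> [_ /(_ i)[_ sl es _]]; case: b. Qed.

(** [q] is the coordinate along the sliding direction, see [reach_origin]. *)
Lemma local_dynamics b i x : slide b i x -> sliding_field Z i x != 0 ->
  exists (q : M -> R) (A eta : R), [/\ 0 < A, 0 < eta,
    \forall y \near x, [/\ {for y, continuous (hfun Z i)}, {for y, continuous q},
      (hfun Z i y = 0 -> q y = 0 -> y = x) &
      forall g, filippov_orbit Z g -> g 0 = y ->
      let h' s := `|hfun Z i (g (time_sign b * s))| in let q' s := q (g (time_sign b * s)) in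
      [/\ \forall s \near 0^'+, h' s <= `|hfun Z i y|,
        \forall s \near 0^'+, q y - A * `|hfun Z i y| + eta * s <= q' s - A * h' s
      & hfun Z i y != 0 -> \forall s \near 0^'+, q' s + A * h' s <= q y + A * `|hfun Z i y|]]
    & forall (s eps : R) (U : set M), `|s| = 1 -> 0 < eps -> (\forall y \near x, U y) ->
      exists y, [/\ U y, q y + A * `|hfun Z i y| < 0, - eps < q y - A * `|hfun Z i y|
        & 0 < s * hfun Z i y]].
Proof.
move=> sx sf0; have /slideP[hx A1x A2x] := sx.
pose e := time_sign b; have ee : e * e = 1 by rewrite /e /time_sign; case: (b); rewrite ?mulrNN mul1r.
pose c := chart_at S x; have cx : cdom c x := chart_at_dom S x.
have ac : atlas S c := chart_at_atlas S x.
pose D := cmap c @` cdom c; pose u0 := cmap c x.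
have Du0 : D u0 by exists x.
pose h := hfun Z i; pose H := h \o cinv c.
have HCk : Ck 1 D H by apply: Ck_Ck1 k0 _; exact: hfun_Ck.
(* [a] is the velocity of the slide through [x] in the direction of time that is followed, so that
   [q] increases there at rate [dot a a]. *)
pose sf := sliding_field Z i x; pose a := e *: sf.
have a0 : a != 0.
  rewrite scaler_eq0 negb_or sf0 andbT; apply/eqP => e0.
  by move: ee; rewrite e0 mul0r => /esym/eqP; rewrite oner_eq0.
pose q := chart_dot c a x.
have qCk : Ck 1 D (q \o cinv c) by exact: chart_dot_Ck.
have H0 : H u0 = 0 by rewrite /H /u0/= cmapK.
have Ha : 'd H u0 a = 0.
  rewrite /a linearZ /= (_ : 'd H u0 sf = 0) ?scaler0//.
  by rewrite -[LHS]/(dfun S h x sf) dfun_sliding -/(Y1h _ _ _) -/(Y2h _ _ _) mulrC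
    [X in _ - X]mulrC subrr mul0r.
(* Otherwise the differential of [h] would vanish on both basis vectors, and [Y1h] would be zero at
   [x]. *)
have Hw : 'd H u0 (rot a) != 0.
  apply: contraTneq A1x => w0.
  suff -> : Y1h Z i x = 0 by rewrite mulr0 ltxx.
  have dE v : 'd H u0 v = (dot a v / dot a a) * 'd H u0 a
      + (dot (rot a) v / dot a a) * 'd H u0 (rot a).
    by rewrite {1}(rot_decomp v a0) linearD !linearZ.
  by rewrite -[LHS]/('d H u0 (Y1 Z i x)) dE Ha w0 !mulr0 addr0.
have Ycont f j : Ck 1 D (f \o cinv c) ->
    {for x, continuous (fun y => dfun S f y (field Z j y))}.
  by move=> fCk; exact: (dfun_continuous k0 r0 ac cx fCk (field_Ck Z j)).
have A1c : Y1h Z i y @[y --> x] --> Y1h Z i x.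
  exact: (Ycont h (pos_side Z i) HCk).
have A2c : Y2h Z i y @[y --> x] --> Y2h Z i x.
  exact: (Ycont h (neg_side Z i) HCk).
pose B1 y := dfun S q y (Y1 Z i y); pose B2 y := dfun S q y (Y2 Z i y).
have B1c : B1 y @[y --> x] --> B1 x.
  exact: (Ycont q (pos_side Z i) qCk).
have B2c : B2 y @[y --> x] --> B2 x.
  exact: (Ycont q (neg_side Z i) qCk).
pose Sl y := dfun S q y (sliding_field Z i y).
have Slc : Sl y @[y --> x] --> Sl x.
  have A12 : Y2h Z i x - Y1h Z i x != 0.
    apply: contraTneq A1x => /subr0_eq E; move: A2x; rewrite E => /ltW.
    by rewrite leNgt.
  rewrite /Sl dfun_sliding; under eq_fun do rewrite dfun_sliding.
  exact: (cvgM (cvgV A12 (cvgB A2c A1c)) (cvgB (cvgM A2c B1c) (cvgM A1c B2c))).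
have eSl : e * Sl x = dot a a.
  have [_ E] := dfun_chart k0 sf ac cx (qCk.1 _ Du0).
  rewrite tcoord_chart_at in E.
  rewrite -[Sl x]/(dfun S q x sf) E.
  have -> := congr1 (fun L : 'rV[R]_2 -> R => L sf) (chart_dot_diff a x Du0).2.
  have aj j : a 0 j = e * sf 0 j by rewrite mxE.
  by rewrite /dot !aj; ring.
have aa := dot_gt0 a0.
pose eta := dot a a / 2; have eta0 : 0 < eta by rewrite divr_gt0.
(* Near [x] and off the curve, |h| shrinks at rate at least [del], half the smaller normal speed,
   while [q] changes at rate at most [K]. By [A * del = K + eta], q - A |h| then grows, and q + A
   |h| decreases, at rate at least [eta]. On the curve [q] grows faster than [eta], which is half
   its speed at [x]. *)
pose del := Num.min (- (e * Y1h Z i x)) (e * Y2h Z i x) / 2.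
have del0 : 0 < del by rewrite divr_gt0// lt_min oppr_gt0 A1x A2x.
pose K := Num.max `|B1 x| `|B2 x| + 1.
have K0 : 0 < K by rewrite ltr_pwDr// le_max normr_ge0.
pose A := (K + eta) / del.
have A0 : 0 < A by rewrite divr_gt0// addr_gt0.
have Adel : A * del = K + eta by rewrite divfK// lt0r_neq0.
exists q, A, eta; split=> //; last first.
  move=> s eps U s1 eps0 xU.
  have xU' : \forall u \near u0, U (cinv c u) /\ D u.
    by apply: filterI; [exact: near_cinv|exact: near_cimg].
  have [u [[Uy [y cy yu]] w1 w2 w3]] :=
    wedge_point a0 (HCk.1 _ Du0) H0 Ha Hw A0 eps0 s1 xU'.
  by exists y; move: Uy w1 w2 w3; rewrite -yu /H/= cmapK.
have eA1 : \forall y \near x, e * Y1h Z i y < - del.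
  apply: (cvgr_lt _ (cvgM (cvg_cst e) A1c)).
  have : del < - (e * Y1h Z i x).
    rewrite /del ltr_pdivrMr// gt_min; apply/orP; left.
    by rewrite ltr_pMr ?oppr_gt0// ltr1n.
  by rewrite ltrNr.
have eA2 : \forall y \near x, del < e * Y2h Z i y.
  apply: (cvgr_gt _ (cvgM (cvg_cst e) A2c)).
  rewrite /del ltr_pdivrMr// gt_min; apply/orP; right.
  by rewrite ltr_pMr// ltr1n.
have eB1 : \forall y \near x, `|B1 y| < K.
  apply: (cvgr_lt _ (cvg_norm B1c)).
  by rewrite /K (@le_lt_trans _ _ (Num.max `|B1 x| `|B2 x|)) ?ltrDl// le_max lexx.
have eB2 : \forall y \near x, `|B2 y| < K.
  apply: (cvgr_lt _ (cvg_norm B2c)).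
  by rewrite /K (@le_lt_trans _ _ (Num.max `|B1 x| `|B2 x|)) ?ltrDl// le_max lexx orbT.
have eS : \forall y \near x, eta < e * Sl y.
  apply: (cvgr_gt _ (cvgM (cvg_cst e) Slc)).
  by rewrite eSl ltr_pdivrMr// ltr_pMr// ltr1n.
have inj : \forall y \near x, h y = 0 -> q y = 0 -> y = x.
  have Hw' : 'D_(rot a) H u0 != 0 by rewrite deriveE//; exact: HCk.1.
  have gi : \forall y \near x, H (cmap c y) = 0 -> dot a (cmap c y - u0) = 0 ->
      cmap c y = u0.
    exact: (cmap_continuous cx (graph_inj a0 (cimg_open (c:=c)) Du0 HCk H0 Hw')).
  move: (near_cdom cx) gi; apply: filterS2 => y cy yE hy qy.
  have /(congr1 (cinv c)) : cmap c y = cmap c x.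
    by apply: yE => //; rewrite /H/= cmapK.
  by rewrite !cmapK.
have xsides := sides hx.
have xc := near_cdom cx.
near=> y.
have cy : cdom c y by near: y.
have Dy : D (cmap c y) by exists y.
have hc : {for y, continuous h} by apply: chart_continuous cy (HCk.1 _ Dy).
have qc : {for y, continuous q} by apply: chart_continuous cy (qCk.1 _ Dy).
have y1 : e * Y1h Z i y < - del by near: y.
have y2 : del < e * Y2h Z i y by near: y.
have y3 : `|B1 y| < K by near: y.
have y4 : `|B2 y| < K by near: y.
have y5 : eta < e * Sl y by near: y.
have [ypos yneg] : (0 < h y -> region Z (pos_side Z i) y) /\
  (h y < 0 -> region Z (neg_side Z i) y) by near: y.
split => //; first by near: y.
move=> g og g0.
pose h' s := `|hfun Z i (g (time_sign b * s))|; pose q' s := q (g (time_sign b * s)).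
have lg := local_orbit0 og.
have gc : {for 0, continuous g} by apply: og.1.
have cg : cdom c (g 0) by rewrite g0.
have rate f v : Ck 1 D (f \o cinv c) -> velocity S (time_side b) g v -> let d := e * dfun S f y v in
  (forall l, l < d -> \forall s \near 0^'+, f y + l * s <= f (g (e * s))) /\
  (forall l, d < l -> \forall s \near 0^'+, f (g (e * s)) <= f y + l * s).
  move=> fCk gv; rewrite -g0; apply: (velocity_rate (c := c)) => //.
  by apply: fCk.1; rewrite g0.
have near_g (P : set M) : (\forall z \near y, P z) -> \forall s \near 0^'+, P (g (e * s)).
  move=> yP.
  have : (fun s => g (e * s)) @ (0 : R) --> g (e * 0).
    have ec : (fun s : R => e * s) @ (0 : R) --> e * 0.
      exact: (cvgM (cvg_cst e) cvg_id).
    have gc' : g @ (e * 0) --> g (e * 0) by rewrite mulr0; exact: gc.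
    exact: (@cvg_comp _ _ _ (fun s => e * s) g _ _ _ ec gc').
  rewrite mulr0 g0 => /(_ _ yP) gP.
  by apply: cvg_within; exact: gP.
have fin : (\forall s \near 0^'+, h' s <= `|h y| - del * s) ->
    (\forall s \near 0^'+, `|q' s - q y| <= K * s) ->
  [/\ \forall s \near 0^'+, h' s <= `|h y|,
        \forall s \near 0^'+, q y - A * `|h y| + eta * s <= q' s - A * h' s
      & h y != 0 -> \forall s \near 0^'+, q' s + A * h' s <= q y + A * `|h y|].
  move=> nh nq; have n0 := @nbhs_right_gt R 0.
  have aux s : h' s <= `|h y| - del * s -> A * h' s <= A * `|h y| - (K + eta) * s.
    by rewrite -Adel -(ler_pM2l A0) => /le_trans; apply; rewrite mulrBr mulrA.
  split.
  - move: nh n0; apply: filterS2 => s h1 s0; apply: le_trans h1 _.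
    by rewrite gerBl mulr_ge0// ltW.
  - move: nh nq n0; apply: filterS3 => s /aux h1; rewrite ler_norml => /andP[h2 h3] s0.
    by move: h1; rewrite mulrDl; lra.
  - move=> _; move: nh nq n0; apply: filterS3 => s /aux h1; rewrite ler_norml => /andP[h2 h3] s0.
    have : 0 < eta * s by exact: mulr_gt0.
    by move: h1; rewrite mulrDl; lra.
have nqB v : velocity S (time_side b) g v -> `|dfun S q y v| < K ->
    \forall s \near 0^'+, `|q' s - q y| <= K * s.
  move=> gv; have {gv} [r1 r2] := rate _ _ qCk gv.
  have -> : `|dfun S q y v| = `|e * dfun S q y v|.
    by rewrite normrM /e /time_sign; case: (b); rewrite ?normrN normr1 mul1r.
  rewrite ltr_norml => /andP[/r1 h1 /r2 h2].
  move: h1 h2; apply: filterS2 => s; rewrite -/(q' s) ler_norml => h1 h2.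
  by rewrite lerBrDl -mulNr h1 lerBlDl h2.
have hcases : [\/ h y < 0, 0 < h y | h y = 0].
  by have [?|?|?] := ltgtP (h y) 0; [constructor 1|constructor 2|constructor 3].
case: hcases => [hneg|hpos|hz].
- have gv : velocity S (time_side b) g (Y2 Z i y).
    by apply: velocity_time_side; rewrite -g0; apply: lg.1; rewrite g0; exact: yneg.
  apply: fin; last exact: nqB gv y4.
  have [r1 _] := rate _ _ HCk gv.
  have n1 := r1 _ y2.
  have n2 : \forall s \near 0^'+, h (g (e * s)) < 0.
    exact: (near_g (fun z => h z < 0) (cvgr_lt _ hc _ hneg)).
  move: n1 n2; apply: filterS2 => s h1 h2; rewrite /h' -/h.
  by rewrite (ltr0_norm h2) (ltr0_norm hneg); lra.
- have gv : velocity S (time_side b) g (Y1 Z i y).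
    by apply: velocity_time_side; rewrite -g0; apply: lg.1; rewrite g0; exact: ypos.
  apply: fin; last exact: nqB gv y3.
  have [_ r1] := rate _ _ HCk gv.
  have n1 := r1 _ y1.
  have n2 : \forall s \near 0^'+, 0 < h (g (e * s)).
    exact: (near_g (fun z => 0 < h z) (cvgr_gt _ hc _ hpos)).
  move: n1 n2; apply: filterS2 => s h1 h2; rewrite /h' -/h.
  by rewrite (gtr0_norm h2) (gtr0_norm hpos); lra.
(* On the curve the sliding or escaping rule keeps the orbit there in the followed direction of
   time: [h'] stays zero and [q] moves with the sliding field. *)
have sy : slide b i (g 0).
  rewrite g0; apply/slideP; split=> //; first by rewrite (lt_trans y1)// oppr_lt0.
  exact: lt_trans y2.
have [/near_time_side gsl gv] := slide_rule lg sy; rewrite g0 in gv.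
have hz' : \forall s \near 0^'+, h' s = 0.
  by apply: filterS gsl => s /slideP[h1 _ _]; rewrite /h' h1 normr0.
have [r1 _] := rate _ _ qCk gv.
rewrite -/h hz normr0 mulr0 subr0; split.
- by apply: filterS hz' => s hs; rewrite -/(h' s) hs.
- move: hz' (r1 _ y5); apply: filterS2 => s hs; rewrite -/(h' s) hs.
  by rewrite mulr0 subr0.
- by rewrite eqxx.
Unshelve. all: by end_near. Qed.

End local.

(** * Uniform bounds over all orbits, and the capture at x *)

Lemma dist_term_le (R : realType) (M : metricType R) (c0 c1 : R -> M) (i : int) :
  compact [set: M] -> dist_term c0 c1 i <= dist_sup c0 c1.
Proof.
move=> cM; rewrite -lee_fin /dist_sup fineK ?dist_sup_fin//.
apply: esum_ge; exists [set i]; first by split => //; exact: finite_set1.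
by rewrite fsbig_set1.
Qed.

Lemma mdist_le_dist_sup (R : realType) (M : metricType R) (c0 c1 : R -> M)
    (i : int) (t : R) : compact [set: M] -> i%:~R <= t < (i + 1)%:~R ->
  mdist (c0 t) (c1 t) <= 2 ^+ absz i * dist_sup c0 c1.
Proof.
move=> cM it; have := dist_term_le c0 c1 i cM.
rewrite /dist_term ler_pdivrMl ?exprn_gt0//.
exact/le_trans/mdist_le_sup.
Qed.

Section side_reaches.
Context (R : realType) (k r n : nat) (M : metricType R).
Context (S : closed_riemannian_surface k M) (Z : filippov_system r n S).
Hypotheses (k0 : (0 < k)%N) (r0 : (0 < r)%N).
Hypothesis compact_orbits : compact [set: orbit_space Z].

(** Each orbit is continuous at time 0, its neighbours in the orbit space are uniformly close to it
    for short times, and finitely many such neighbourhoods cover the compact orbit space. *)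
Lemma orbits_equicontinuous (eps : R) : 0 < eps ->
  exists2 T : R, 0 < T & forall g t, filippov_orbit Z g -> `|t| <= T ->
    mdist (g 0) (g t) < eps.
Proof.
move=> e0; have cM : compact [set: M] := surface_compact S.
have e4 : 0 < eps / 4 by rewrite divr_gt0.
have := compact_near_coveringP [set: orbit_space Z] => -[/(_ compact_orbits)].
move=> /(_ R 0^'+ (fun T g => forall t, `|t| <= T -> mdist (sval g 0) (sval g t) < eps) _).
case=> [|T0 /= T0p TP].
- move=> g _.
  have [d /= d0 gd] : exists2 d : R, 0 < d & forall t, `|t| < d -> mdist (sval g 0) (sval g t) < eps / 4.
    have : \forall y \near sval g 0, mdist (sval g 0) y < eps / 4.
      apply/nbhs_ballP; exists (eps / 4) => //= y; rewrite ballEmdist /=.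
      by rewrite metric_sym.
    move=> /((svalP g).1 0) /nbhs_ballP[d /= d0 dP]; exists d => // t td.
    by apply: dP; rewrite /ball/= sub0r normrN.
  (* For [T < 1] only the terms of index 0 and -1 of the metric matter. The latter has weight 1/2,
     so [eps / 8] between orbits allows [eps / 4] at each time. *)
  exists (ball g (eps / 8), [set T : R | T < d /\ T < 1]).
    split; first by apply: nbhsx_ballx; rewrite divr_gt0.
    by apply: filterI; apply: nbhs_right_lt.
  move=> [f T] /= [gf [Td T1]] t tT.
  have {gf} fg : dist_sup (sval g) (sval f) < eps / 8 by move: gf; rewrite ballEmdist /=.
  have close u : `|u| <= T -> mdist (sval g u) (sval f u) < eps / 4.
    rewrite ler_norml => /andP[u1 u2].
    have [u0|u0] := leP 0 u.
      have := @mdist_le_dist_sup R M (sval g) (sval f) 0 u cM.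
      by rewrite u0/= expr0 (le_lt_trans u2 T1) => /(_ isT); lra.
    have := @mdist_le_dist_sup R M (sval g) (sval f) (-1) u cM.
    by rewrite addNr u0 andbT expr1 (_ : -1 <= u) => [/(_ isT)|]; lra.
  have T0 : 0 <= T := le_trans (normr_ge0 t) tT.
  have h1 := close 0; rewrite normr0 in h1; have {}h1 := h1 T0.
  have h2 := close t tT; have h3 := gd t (le_lt_trans tT Td).
  have h4 := metric_triangle (sval f 0) (sval g 0) (sval f t).
  have h5 := metric_triangle (sval g 0) (sval g t) (sval f t).
  by rewrite metric_sym in h1; lra.
have T02 : 0 < T0 / 2 by rewrite divr_gt0.
exists (T0 / 2) => // g t og tT.
apply: (TP (T0 / 2) _ _ (exist _ g og)) => //=.
rewrite /ball/= sub0r normrN gtr0_norm// ltr_pdivrMr// ltr_pMr// ltr1n//.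
Qed.

Lemma side_reaches b i x (s : R) : slide Z b i x -> sliding_field Z i x != 0 -> `|s| = 1 ->
  exists W : set M, [/\ open W, W !=set0, W `<=` [set y | 0 < s * hfun Z i y] &
    forall g, filippov_orbit Z g -> W (g 0) ->
      exists tau, [/\ 0 < tau, g (time_sign R b * tau) = x &
        forall u, 0 <= u <= tau -> 0 <= s * hfun Z i (g (time_sign R b * u))]].
Proof.
move=> sx sf0 s1.
have [q [A [eta [A0 eta0 /nbhs_ballP[rho /= rho0 ball_rho] wedge]]]] :=
  local_dynamics k0 r0 sx sf0.
have rho2 : 0 < rho / 2 by rewrite divr_gt0.
have [T T0 equi] := orbits_equicontinuous rho2.
have eT : 0 < eta * T by rewrite mulr_gt0.
pose h := hfun Z i; pose e := time_sign R b.
(* The lower bound is matched to [T]: growing at rate [eta], q - A |h| is nonnegative by time [T].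
   The upper bound is the condition under which [reach_origin] puts its zero on the curve. *)
pose W := [set y | [/\ ball x (rho / 2) y, q y + A * `|h y| < 0,
  - (eta * T) < q y - A * `|h y| & 0 < s * h y]].
have half : rho / 2 < rho by rewrite ltr_pdivrMr// ltr_pMr// ltr1n.
exists W°; split.
- exact: open_interior.
- have [|y [yb w1 w2 w3]] := wedge s (eta * T) (ball x (rho / 2)) s1 eT.
    exact: nbhsx_ballx.
  exists y; have [hc qc _ _] := ball_rho y (le_ball (ltW half) yb).
  have Ahc : A * `|h z| @[z --> y] --> A * `|h y|.
    by apply: cvgM; [exact: cvg_cst|exact: (cvg_norm hc)].
  have n1 := cvgr_lt _ (cvgD qc Ahc) _ w1.
  have n2 := cvgr_gt _ (cvgB qc Ahc) _ w2.
  have n3 := cvgr_gt _ (cvgM (cvg_cst s) hc) _ w3.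
  have n4 : \forall z \near y, ball x (rho / 2) z.
    move: yb; rewrite ballEmdist /= => yb.
    apply/nbhs_ballP; exists (rho / 2 - mdist x y) => /=; first by rewrite subr_gt0.
    move=> z; rewrite !ballEmdist /= ltrBrDl; apply: le_lt_trans.
    exact: metric_triangle.
  have n34 : \forall z \near y, 0 < s * h z /\ ball x (rho / 2) z.
    by apply: filterI; [exact: n3|exact: n4].
  suff : \forall z \near y, W z by [].
  near=> z; split.
  - by have [] : 0 < s * h z /\ ball x (rho / 2) z by near: z.
  - by near: z; exact: n1.
  - by near: z; exact: n2.
  - by have [] : 0 < s * h z /\ ball x (rho / 2) z by near: z.
- by move=> y Wy; have [] : W y by exact: interior_subset Wy.
move=> g og Wg.
have [gb g1 g2 g3] : W (g 0) by exact: interior_subset Wg.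
have inball t : 0 <= t <= T -> ball x rho (g (e * t)).
  move=> /andP[t0 tT]; rewrite ballEmdist/=.
  have et : `|e * t| <= T.
    by rewrite /e /time_sign; case: (b); rewrite ?mul1r ?mulN1r ?normrN ger0_norm.
  have h1 := equi g (e * t) og et.
  have h2 : mdist x (g 0) < rho / 2 by move: gb; rewrite ballEmdist /=.
  have h3 := metric_triangle x (g 0) (g (e * t)).
  by lra.
(* The local estimates are stated at time 0; the orbit restarted at each time [e * t] yields them
   all along the way. *)
have gshift t : filippov_orbit Z (fun u => g (e * t + u)).
  exact: filippov_orbit_shift.
have gec t : (fun u => g (e * u)) @ t --> g (e * t).
  have ec : (fun u : R => e * u) @ t --> e * t by exact: (cvgM (cvg_cst e) cvg_id).
  exact: (@cvg_comp _ _ _ (fun u => e * u) g _ _ _ ec (og.1 (e * t))).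
have dini t : 0 <= t < T ->
    [/\ \forall u \near 0^'+, `|h (g (e * (t + u)))| <= `|h (g (e * t))|,
      \forall u \near 0^'+, q (g (e * t)) - A * `|h (g (e * t))| + eta * u <=
        q (g (e * (t + u))) - A * `|h (g (e * (t + u)))|
    & h (g (e * t)) != 0 -> \forall u \near 0^'+,
        q (g (e * (t + u))) + A * `|h (g (e * (t + u)))| <=
        q (g (e * t)) + A * `|h (g (e * t))|].
  move=> /andP[t0 tT]; have tT' : 0 <= t <= T by rewrite t0 ltW.
  have [_ _ _ D] := ball_rho _ (inball t tT').
  have E u : g (e * t + time_sign R b * u) = g (e * (t + u)) by rewrite mulrDr.
  have [d1 d2 d3] := D _ (gshift t) (congr1 g (addr0 _)); split.
  - by move: d1; apply: filterS => u; rewrite E.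
  - by move: d2; apply: filterS => u; rewrite E.
  - by move=> /d3; apply: filterS => u; rewrite E.
have [|||||||tau [/andP[tau0 tauT] ptau qtau sgn]] := @reach_origin R
  (fun t => h (g (e * t))) (fun t => q (g (e * t))) A eta T (ltW A0) (ltW T0).
- move=> t tT; have [hc _ _ _] := ball_rho _ (inball t tT).
  exact: (@cvg_comp _ _ _ (fun u => g (e * u)) h _ _ _ (gec t) hc).
- move=> t tT; have [_ qc _ _] := ball_rho _ (inball t tT).
  exact: (@cvg_comp _ _ _ (fun u => g (e * u)) q _ _ _ (gec t) qc).
- by move=> t /dini[].
- by move=> t /dini[].
- by move=> t /dini[].
- by rewrite /= mulr0.
- by move: g2; rewrite /= mulr0; lra.
exists tau; split=> //.
  have tT : 0 <= tau <= T by rewrite ltW.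
  by have [_ _ inj _] := ball_rho _ (inball tau tT); exact: inj.
move=> u utau; have := sgn u utau; rewrite /= mulr0 => pu.
have p0 : 0 < (h (g 0)) ^+ 2.
  by rewrite exprn_even_gt0//=; apply: contraTneq g3 => ->; rewrite mulr0 ltxx.
rewrite -(pmulr_lge0 _ p0) (_ : s * _ * _ = s * h (g 0) * (h (g 0) * h (g (e * u)))).
  by apply: mulr_ge0 => //; exact: ltW.
by rewrite -/h -/e; ring.
Unshelve. all: by end_near. Qed.

End side_reaches.

(** * Loops and their concatenation *)

Lemma last_before (R : realType) (E : set R) (t1 t0 : R) :
  closed E -> E t1 -> t1 <= t0 ->
  exists a, [/\ E a, t1 <= a <= t0 & forall t, a < t <= t0 -> ~ E t].
Proof.
move=> cE E1 t10; pose F := E `&` [set t | t <= t0].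
have F1 : F t1 by [].
have bF : has_sup F by split; [exists t1|exists t0 => t []].
have cF : closed F by apply: closedI => //; exact: closed_le.
have [Ea at0] : F (sup F).
  by apply: cF; apply: closure_sup => //; [exists t1|case: bF].
exists (sup F); split=> //.
  by rewrite at0 andbT; apply: ub_le_sup => //; case: bF.
move=> t /andP[at_ tt0] Et; suff : t <= sup F by rewrite leNgt at_.
by apply: ub_le_sup; [case: bF|].
Qed.

Lemma first_after (R : realType) (E : set R) (t2 t0 : R) :
  closed E -> E t2 -> t0 <= t2 ->
  exists a, [/\ E a, t0 <= a <= t2 & forall t, t0 <= t < a -> ~ E t].
Proof.
move=> cE E2 t20.
have [|||a [Ea a1 a2]] := @last_before R [set t | E (- t)] (- t2) (- t0).
- by apply: (closed_comp _ cE) => t _; exact: opp_continuous.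
- by rewrite /= opprK.
- by rewrite lerN2.
exists (- a); split=> //; first by rewrite lerNr lerNl andbC.
move=> t /andP[t0t ta]; have := a2 (- t); rewrite /= opprK; apply.
by rewrite ltrNr ta lerN2.
Qed.

Definition splice (R : realType) (M : Type) (c d : R -> M) : R -> M :=
  fun t => if t < 0 then c t else d t.

Section loops.
Context (R : realType) (k r n : nat) (M : metricType R).
Context (S : closed_riemannian_surface k M) (Z : filippov_system r n S).

Lemma velocity_germ (F : set_system R) (FF : Filter F) (c d : R -> M) v :
  c 0 = d 0 -> (\forall s \near F, c s = d s) ->
  velocity S F c v -> velocity S F d v.
Proof.
move=> cd0 cd; rewrite /velocity cd0; apply: cvg_near.
by apply: filterS cd => s ->.
Qed.

(** Only the tangency clause looks at velocities at later times; its interval is cut down to one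
    where the two curves agree. *)
Lemma local_orbit_germ (c d : R -> M) : (\forall s \near 0, c s = d s) ->
  local_orbit Z c -> local_orbit Z d.
Proof.
move=> cd [cr cs]; have cd0 := nbhs_singleton cd.
have cdr : \forall s \near 0^'+, c s = d s by exact: cvg_within cd.
have cdl : \forall s \near 0^'-, c s = d s by exact: cvg_within cd.
have cdN : \forall s \near 0^'+, c (- s) = d (- s).
  have := at_leftN (0 : R); rewrite oppr0 => E.
  by move: cdl; rewrite E near_map.
split=> [j|i].
  rewrite -cd0 => /cr; apply: velocity_germ => //; exact: cvg_within cd.
have [ic is_ ie it] := cs i; rewrite -cd0; split.
- move=> /ic; move: cdr cdN; apply: filterS3 => s -> ->.
  by rewrite cd0.
- move=> /is_[h1 h2]; split; last exact: velocity_germ h2.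
  by move: cdr h1; apply: filterS2 => s ->.
- move=> /ie[h1 h2]; split; last exact: velocity_germ h2.
  by move: cdl h1; apply: filterS2 => s ->.
move=> /it[e e0 h]; have /nbhs_ballP[e1 /= e10 cdb] := cd.
have cdE s : 0 <= s < e1 -> c s = d s.
  by move=> /andP[s0 s1]; apply: cdb; rewrite /ball/= sub0r normrN ger0_norm.
have cdG s v : 0 <= s < e1 -> velocity S 0^'+ (fun u => c (s + u)) v ->
    velocity S 0^'+ (fun u => d (s + u)) v.
  move=> se; apply: velocity_germ; first by rewrite addr0 cdE.
  have := @nbhs_right_lt R 0 (e1 - s); rewrite subr_gt0.
  case/andP: (se) => s0 -> /(_ isT); move: (@nbhs_right_gt R 0).
  apply: filterS2 => u u0 ue; apply: cdE.
  by apply/andP; split; [rewrite addr_ge0// ltW|rewrite -ltrBrDl].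
exists (Num.min e e1); first by rewrite lt_min e0.
case: h => h; [constructor 1|constructor 2|constructor 3] => s;
  rewrite lt_min => /and3P[s0 se se1].
- have [|h1 h2] := h s; first by rewrite s0.
  have s01 : 0 <= s < e1 by rewrite s0.
  by rewrite -cdE//; split=> //; exact: cdG.
- have [|h1 h2] := h s; first by rewrite s0.
  have s01 : 0 <= s < e1 by rewrite s0.
  by rewrite -cdE//; split=> //; exact: cdG.
- by rewrite -cdE ?(ltW s0)//; apply: h; rewrite s0.
Qed.

Lemma near_lt0 (t : R) : t < 0 -> \forall s \near 0, t + s < 0.
Proof.
move=> t0; apply/nbhs_ballP; exists (- t); first by rewrite /= oppr_gt0.
move=> s; rewrite /ball/= sub0r normrN => /ltr_normlP[_]; lra.
Qed.

Lemma near_gt0 (t : R) : 0 < t -> \forall s \near 0, 0 < t + s.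
Proof.
move=> t0; apply/nbhs_ballP; exists t => //= s.
by rewrite /ball/= sub0r normrN => /ltr_normlP[]; lra.
Qed.

(** The two derivatives have opposite signs there and the switching curves are disjoint. Hence only
    the sliding and escaping clauses remain to be checked at a junction. *)
Lemma slide_exclusive b i j x : slide Z b i x ->
  [/\ ~ region Z j x, forall i', ~ crossing Z i' x & forall i', ~ tangency Z i' x].
Proof.
move=> /slideP[hx y1 y2]; have sw : switching_set (hfun Z) x by exists i.
have same i' : hfun Z i' x = 0 -> i' = i.
  move=> hx'; apply/eqP/negPn/negP => /(curves_disjoint Z) E.
  by have : (switching_curve (hfun Z) i' `&` switching_curve (hfun Z) i) x by []; rewrite E.
have y12 : Y1h Z i x * Y2h Z i x < 0.
  rewrite -[ltLHS]mul1r (_ : 1 = time_sign R b * time_sign R b).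
    by rewrite mulrACA nmulr_rlt0.
  by rewrite /time_sign; case: (b); rewrite ?mulrNN mul1r.
split=> [rx|i' [hx' y]|i' [hx' y]].
- have : (\bigcup_j region Z j) x by exists j.
  by rewrite (region_cover Z).
- by move: y12; rewrite -(same _ hx') => /(lt_trans y); rewrite ltxx.
- by move: y12; rewrite -(same _ hx') y ltxx.
Qed.

Lemma splice_orbit b i (c d : R -> M) : filippov_orbit Z c ->
  filippov_orbit Z d -> c 0 = d 0 -> slide Z b i (d 0) ->
  filippov_orbit Z (splice c d).
Proof.
move=> [cc co] [dc do_] cd0 sl.
have near_c t : t < 0 -> \forall s \near 0, c (t + s) = splice c d (t + s).
  by move=> /near_lt0; apply: filterS => s ts; rewrite /splice ts.
have near_d t : 0 < t -> \forall s \near 0, d (t + s) = splice c d (t + s).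
  by move=> /near_gt0; apply: filterS => s ts; rewrite /splice ltNge ltW.
split.
  have contE (f g : R -> M) t : (\forall s \near 0, f (t + s) = g (t + s)) ->
      {for t, continuous f} -> {for t, continuous g}.
    move=> fg; have := nbhs_singleton fg; rewrite addr0 => fgt.
    have fg' : \forall s \near t, f s = g s.
      rewrite (near_shift 0 t) subr0; apply: filterS fg => s /=.
      by rewrite addrC.
    by rewrite /prop_for /continuous_at fgt; apply: cvg_near.
  move=> t; have [t0|t0|->] := ltgtP t 0.
  - exact: contE (near_c t t0) (cc t).
  - exact: contE (near_d t t0) (dc t).
  move=> U; rewrite {1}/splice ltxx => dU.
  have cU : nbhs (c 0) U by rewrite cd0.
  have cdU : \forall s \near 0, U (c s) /\ U (d s).
    by apply: filterI; [exact: cc cU|exact: dc dU].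
  suff : \forall s \near 0, U (splice c d s) by [].
  by apply: filterS cdU => s [Uc Ud]; rewrite /splice; case: ifP.
move=> t; have [t0|t0|->] := ltgtP t 0.
- exact: local_orbit_germ (near_c t t0) (co t).
- exact: local_orbit_germ (near_d t t0) (do_ t).
have s0 : splice c d (0 + 0) = d 0 by rewrite addr0 /splice ltxx.
have nr : \forall s \near 0^'+, d (0 + s) = splice c d (0 + s).
  have := @nbhs_right_gt R 0; apply: filterS => s s0'.
  by rewrite /splice add0r ltNge ltW.
have nl : \forall s \near 0^'-, c (0 + s) = splice c d (0 + s).
  by have := @nbhs_left_lt R 0; apply: filterS => s s0'; rewrite /splice add0r s0'.
split=> [j|i']; rewrite s0; first by have [h _ _] := slide_exclusive j sl.
have [_ h1 h2] := slide_exclusive (pos_side Z i) sl; split.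
- by move=> /h1.
- have [_ /(_ i')[_ + _ _]] := do_ 0; rewrite addr0 => /[apply] -[h3 h4].
  split; last by apply: velocity_germ h4 => //; rewrite s0 addr0.
  by move: nr h3; apply: filterS2 => s ->.
- have [_ /(_ i')[_ _ + _]] := co 0; rewrite addr0 cd0 => /[apply] -[h3 h4].
  split; last by apply: velocity_germ h4 => //; rewrite s0 addr0.
  by move: nl h3; apply: filterS2 => s ->.
- by move=> /h2.
Qed.

(** The last clause makes [T] the first return time, by which loops of different periods are told
    apart. *)
Definition loop (x : M) (g : R -> M) (T : R) : Prop :=
  [/\ filippov_orbit Z g, 0 < T, g 0 = x, g T = x &
    forall t, 0 < t < T -> g t <> x].

(** The loop runs from the last visit to [x] before [t0] to the first one after it; both exist
    because the times of visit form a closed set. *)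
Lemma loop_around x (g : R -> M) (t1 t0 t2 : R) : filippov_orbit Z g ->
  t1 <= t0 <= t2 -> g t1 = x -> g t2 = x -> g t0 <> x ->
  exists a T, [/\ t1 <= a < t0, t0 < a + T <= t2 & loop x (fun u => g (a + u)) T].
Proof.
move=> og /andP[t10 t02] g1 g2 g0.
have cE : closed [set t | g t = x].
  rewrite (_ : [set t | _] = g @^-1` [set x])//.
  apply: (closed_comp (fun t _ => og.1 t)); apply: accessible_closed_set1.
  by apply: hausdorff_accessible; exact: metric_hausdorff.
have [a [ga /andP[ta at_] na]] := last_before cE g1 t10.
have [b [gb /andP[tb bt] nb]] := first_after cE g2 t02.
have at0 : a < t0.
  by rewrite lt_neqAle at_ andbT; apply/eqP => E; apply: g0; rewrite -E.
have bt0 : t0 < b.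
  by rewrite lt_neqAle tb andbT; apply/eqP => E; apply: g0; rewrite E.
exists a, (b - a); split; rewrite ?ta ?at0 ?subrKC ?bt0//.
split.
- exact: filippov_orbit_shift.
- by rewrite subr_gt0 (lt_trans at0).
- by rewrite addr0.
- by rewrite subrKC.
move=> t /andP[t0' tb']; have [h|h] := leP (a + t) t0.
  by apply: na; rewrite h andbT ltrDl.
by apply: nb; rewrite (ltW h) /= -ltrBrDl.
Qed.

End loops.

(** * Separated orbits and entropy *)

Section entropy_pos.
Context (R : realType) (K : metricType R) (f : K -> K).
Hypotheses (compactK : compact [set: K]) (f_cont : continuous f).

Lemma iter_continuous i : continuous (iter i f).
Proof.
elim: i => [|i IH] x /=; first exact: cvg_id.
by apply: (@continuous_comp _ _ _ (iter i f) f); [exact: IH|exact: f_cont].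
Qed.

Lemma finite_spanning m (eps : R) : 0 < eps ->
  exists p, exists2 E, spanning f m eps E & (E #= `I_p)%card.
Proof.
move=> e0.
pose U (x : K) := [set y | forall i, (i < m)%N -> mdist (iter i f y) (iter i f x) < eps].
have nU x : \forall y \near x, U x y.
  rewrite /U {U}; elim: m => [|j IH]; first by near=> y.
  have nj : \forall y \near x, mdist (iter j f y) (iter j f x) < eps.
    apply: (@iter_continuous j x [set z | mdist z (iter j f x) < eps]).
    apply/nbhs_ballP; exists eps => //= z; rewrite ballEmdist /=.
    by rewrite metric_sym.
  move: IH nj; apply: filterS2 => y IH nj i; rewrite ltnS leq_eqVlt => /orP[/eqP->//|].
  exact: IH.
(* The filter of the families containing some finite set: a property that holds near every point
   along [G] holds everywhere for one finite set, which is a finite subcover. *)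
pose G : set_system (set K) :=
  [set A | exists2 D, finite_set D & forall E, D `<=` E -> A E].
have FG : Filter G.
  split; first by exists set0.
    move=> A B [D fD DA] [D' fD' DB]; exists (D `|` D'); first by rewrite finite_setU.
    by move=> E; rewrite subUset => -[DE D'E]; split; [exact: DA|exact: DB].
  by move=> A B AB [D fD DA]; exists D => // E /DA; exact: AB.
have := (compact_near_coveringP _).1 compactK _ G
  (fun E x => exists2 a, E a & U a x) FG.
case=> [x _|D [p Dp] cover].
  exists (U x, [set E | E x]) => [|[y E] [/= Uy Ex]]; last by exists x.
  split; first exact: nU.
  by exists [set x] => [|E]; [exact: finite_set1|exact].
exists p, D => // x; have [a Da Ua] := cover D (@subset_refl _ D) x I.
by exists a.
Unshelve. all: by end_near. Qed.

(** Rules out the junk value of [span_number]. *)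
Lemma span_numberP m (eps : R) : 0 < eps ->
  (exists2 E, spanning f m eps E & (E #= `I_(span_number f m eps))%card) /\
  forall E q, spanning f m eps E -> (E #= `I_q)%card -> (span_number f m eps <= q)%N.
Proof.
move=> e0; rewrite /span_number; set A := [set p | _ /\ _].
suff h : A (xget 0%N A) by exact: h.
apply: xgetPex; rewrite {}/A /=.
pose P p := `[< exists2 E, spanning f m eps E & (E #= `I_p)%card >].
have exP : exists p, P p by have [p h] := finite_spanning m e0; exists p; apply/asboolP.
case: (ex_minnP exP) => p /asboolP Pp minp; exists p; split=> // E q sE Eq.
by apply: minp; apply/asboolP; exists E.
Qed.

Lemma span_number_anti m (e1 e2 : R) : 0 < e1 -> e1 <= e2 ->
  (span_number f m e2 <= span_number f m e1)%N.
Proof.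
move=> e10 e12; have e20 := lt_le_trans e10 e12.
have [[E sE cE] _] := span_numberP m e10; have [_] := span_numberP m e20; apply; [|exact: cE].
move=> x; have [a Ea xa] := sE x; exists a => // i im.
by rewrite (lt_le_trans (xa i im)).
Qed.

Lemma span_number_gt0 m (eps : R) : 0 < eps -> K -> (0 < span_number f m eps)%N.
Proof.
move=> e0 x; have [[E sE cE] _] := span_numberP m e0; rewrite lt0n; apply/eqP => s0.
move: cE; rewrite s0 II0 card_eq0 => /eqP E0.
by have [a] := sE x; rewrite E0.
Qed.

(** Pigeonhole: by the triangle inequality, one element of a set spanning at scale [delta / 2]
    cannot serve two points that are [delta] apart at some time. *)
Lemma separated_span_number (I : finType) (F : I -> K) m (delta : R) : 0 < delta ->
  (forall w w', w <> w' -> exists2 j, (j < m)%N &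
    delta <= mdist (iter j f (F w)) (iter j f (F w'))) ->
  (#|I| <= span_number f m (delta / 2))%N.
Proof.
move=> d0 sep; have d2 : 0 < delta / 2 by rewrite divr_gt0.
have [[E sE /card_set_bijP[h [hE hinj _]]] _] := span_numberP m d2.
set p := span_number _ _ _ in hE *.
have /choice[a aP] : forall w, exists a, E a /\ forall i, (i < m)%N ->
    mdist (iter i f (F w)) (iter i f a) < delta / 2.
  by move=> w; have [a Ea wa] := sE (F w); exists a.
have hp w : (h (a w) < p)%N by have [Ea _] := aP w; have := hE _ Ea.
have inj : injective (fun w => Ordinal (hp w)).
  move=> w w' /(congr1 val) /= hh.
  have aw : a w = a w'.
    by apply: hinj => //; rewrite inE; [case: (aP w)|case: (aP w')].
  apply: contrapT => /sep[j jm].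
  have := (aP w).2 j jm; have := (aP w').2 j jm; rewrite aw metric_sym => h1 h2.
  have := metric_triangle (iter j f (F w)) (iter j f (a w')) (iter j f (F w')).
  by rewrite metric_sym; lra.
by have := leq_card _ inj; rewrite card_ord.
Qed.

Let growth (eps : R) : \bar R :=
  limn_esup (fun m => (m%:R^-1 * ln (span_number f m eps)%:R)%:E).

(** Monotonicity in the scale makes the limit defining the entropy exist, as a supremum, so that a
    lower bound at one scale suffices. *)
Lemma growth_anti (e1 e2 : R) : K -> 0 < e1 -> e1 <= e2 -> (growth e2 <= growth e1)%E.
Proof.
move=> x e10 e12; apply: le_ereal_inf_tmp => _ [V FV <-].
apply: le_trans (_ : ereal_sup [set (m%:R^-1 * ln (span_number f m e2)%:R)%:E | m in V] <= _)%E.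
  by apply: ereal_inf_lbound; exists V.
apply: ge_ereal_sup => _ [m Vm <-].
apply: le_trans (_ : (m%:R^-1 * ln (span_number f m e1)%:R)%:E <= _)%E.
  rewrite lee_fin ler_wpM2l// ler_ln ?posrE ?ltr0n ?span_number_gt0//.
    by rewrite ler_nat span_number_anti.
  exact: lt_le_trans e12.
by apply: ereal_sup_ubound; exists m.
Qed.

(** The words of length [N.+1] separate strictly before time [N.+1 * Q.+1], which gives a growth
    rate of at least [ln 2 / Q.+1]; one more unit per letter makes the non-strict bound on [j]
    strict. *)
Lemma topological_entropy_gt0 (F : seq bool -> K) (delta : R) (Q : nat) :
  0 < delta ->
  (forall w w', size w = size w' -> w <> w' -> exists2 j, (j <= size w * Q)%N &
    delta <= mdist (iter j f (F w)) (iter j f (F w'))) ->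
  (0 < topological_entropy f)%E.
Proof.
move=> d0 sep; have d2 : 0 < delta / 2 by rewrite divr_gt0.
pose c : R := ln 2 / (Q.+1)%:R.
have ln2 : 0 < ln 2 :> R by rewrite ln_gt0// ltr1n.
have c0 : 0 < c by rewrite divr_gt0.
have card N : (2 ^ N.+1 <= span_number f (N.+1 * Q.+1) (delta / 2))%N.
  rewrite (_ : (2 ^ N.+1)%N = #|{: N.+1.-tuple bool}|); last first.
    by rewrite card_tuple card_bool.
  apply: (separated_span_number (F := fun w : N.+1.-tuple bool => F w)) => // w w' ww.
  have [||j jN dj] := sep w w'; first by rewrite !size_tuple.
    by move=> h; apply: ww; exact: val_inj.
  by exists j => //; move: jN; rewrite size_tuple mulnS; lia.
(* An upper limit is bounded below by one good [m] in each neighbourhood of infinity, here a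
   multiple of [Q.+1]. *)
have cG : (c%:E <= growth (delta / 2))%E.
  apply: le_ereal_inf_tmp => _ [V [N _ NV] <-].
  pose m := (N.+1 * Q.+1)%N.
  apply: le_trans (_ : (m%:R^-1 * ln (span_number f m (delta / 2))%:R)%:E <= _)%E; last first.
    by apply: ereal_sup_ubound; exists m => //; apply: NV; rewrite /= /m; nia.
  rewrite lee_fin mulrC ler_pdivlMr ?ltr0n ?muln_gt0//.
  apply: (@le_trans _ _ (ln (2 ^ N.+1)%:R)); last first.
    rewrite ler_ln ?posrE ?ltr0n ?expn_gt0 ?span_number_gt0// ?ler_nat//.
    exact: F [::].
  rewrite natrX lnXn// -[ln 2 *+ _]mulr_natr /c /m natrM [N.+1%:R * _]mulrC.
  by rewrite mulrA divfK.
have mono : {in Interval (BRight 0) (BRight (delta / 2)) &, nonincreasing_fun growth}.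
  by move=> e1 e2; rewrite !in_itv/= => /andP[e10 _] _; apply: growth_anti => //; exact: F [::].
have lim := nonincreasing_at_right_cvge _ _ mono.
rewrite /topological_entropy (cvg_lim _ (lim _))//.
apply: (@lt_le_trans _ _ c%:E); first by rewrite lte_fin.
apply: le_trans cG _; apply: ereal_sup_ubound; exists (delta / 2) => //=.
by rewrite in_itv/= d2 lexx.
Qed.

End entropy_pos.

(** * The two loops *)

Section two_loops.
Context (R : realType) (k r n : nat) (M : metricType R).
Context (S : closed_riemannian_surface k M) (Z : filippov_system r n S).
Hypotheses (k0 : (0 < k)%N) (r0 : (0 < r)%N).
Hypothesis compact_orbits : compact [set: orbit_space Z].
Hypothesis transitiveZ : transitive_system Z.

(** For a sliding point the orbit goes from the wedge [V] on the opposite side to [W] on the side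
    [s]. Being caught from [V] before it can change sides, it visits [x] before time [t]; being
    caught from [W], it does so again afterwards. The loop is cut around time [t], when the orbit is
    in [W]. *)
Lemma side_loop b i x (s : R) : slide Z b i x -> sliding_field Z i x != 0 -> `|s| = 1 ->
  exists g T u, [/\ loop Z x g T, 0 < u < T, 0 < s * hfun Z i (g u) &
    forall v, (if b then u <= v <= T else 0 <= v <= u) -> 0 <= s * hfun Z i (g v)].
Proof.
move=> sl sf0 s1; have hx : hfun Z i x = 0 by have /slideP[] := sl.
have sN1 : `|- s| = 1 by rewrite normrN.
have [W [oW W0 Wpos trapW]] := side_reaches k0 r0 compact_orbits sl sf0 s1.
have [V [oV V0 Vpos trapV]] := side_reaches k0 r0 compact_orbits sl sf0 sN1.
have nx y : 0 < s * hfun Z i y -> y <> x by move=> + yx; rewrite yx hx mulr0 ltxx.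
case: b sl trapW trapV => sl; rewrite /time_sign => trapW trapV.
- have [d [od [t [t0 Vd Wd]]]] := transitiveZ oV oW V0 W0.
  have ot : filippov_orbit Z (fun u => d (t + u)) by exact: filippov_orbit_shift.
  have [t1 [t1p d1 h1]] := trapV d od Vd.
  have [|t2 [t2p d2 h2]] := trapW _ ot; first by rewrite addr0.
  rewrite mul1r in d1; rewrite mul1r in d2.
  have ht := Wpos _ Wd; rewrite /= in ht.
  have t1t : t1 <= t.
    rewrite leNgt; apply/negP => tt1; have := h1 t.
    rewrite t0 (ltW tt1) mul1r => /(_ isT); rewrite mulNr oppr_ge0.
    by rewrite leNgt ht.
  have [|a [T [/andP[ta at_] /andP[aT Tt] lp]]] :=
    loop_around od _ d1 d2 (nx _ ht).
    by rewrite t1t lerDl ltW.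
  exists (fun u => d (a + u)), T, (t - a); split=> //.
  + by rewrite subr_gt0 at_ ltrBlDl.
  + by rewrite subrKC.
  + move=> v /andP[v1 v2]; have := h2 (a + v - t).
    rewrite mul1r subrKC; apply; apply/andP; split; lra.
(* Backwards in time the roles are exchanged: the orbit starts in [W], and the loop is cut around
   time 0. *)
- have [d [od [t [t0 Wd Vd]]]] := transitiveZ oW oV W0 V0.
  have ot : filippov_orbit Z (fun u => d (t + u)) by exact: filippov_orbit_shift.
  have [t1 [t1p d1 h1]] := trapW d od Wd.
  have [|t2 [t2p d2 h2]] := trapV _ ot; first by rewrite addr0.
  rewrite mulN1r in d1; rewrite mulN1r in d2.
  have ht := Wpos _ Wd; rewrite /= in ht.
  have t2t : 0 <= t - t2.
    rewrite leNgt; apply/negP => tt; have tt2 : 0 <= t <= t2 by rewrite t0/=; lra.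
    by have := h2 t tt2; rewrite mulN1r subrr mulNr oppr_ge0 leNgt ht.
  have [|a [T [/andP[ta at_] /andP[aT Tt] lp]]] :=
    loop_around od _ d1 d2 (nx _ ht).
    by rewrite oppr_le0 (ltW t1p).
  exists (fun u => d (a + u)), T, (- a); split=> //.
  + by rewrite oppr_gt0 at_/=; lra.
  + by rewrite subrr.
  + move=> v /andP[v1 v2]; have := h1 (- (a + v)).
    by rewrite mulN1r opprK; apply; apply/andP; split; lra.
Qed.

Lemma two_loops b i x : slide Z b i x -> sliding_field Z i x != 0 ->
  exists (g : bool -> R -> M) (T : bool -> R), (forall c, loop Z x (g c) (T c)) /\
    (T true = T false -> exists2 s, 0 < s < T true & g true s <> g false s).
Proof.
move=> sl sf0.
have [g1 [T1 [u1 [l1 uT1 h1 k1]]]] := side_loop sl sf0 (normr1 R).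
have [g2 [T2 [u2 [l2 uT2 h2 k2]]]] := side_loop sl sf0 (normrN1 R).
exists (fun c : bool => if c then g1 else g2), (fun c : bool => if c then T1 else T2).
split=> [[]//|/= T12]; have [u10 u1T] := andP uT1; have [u20 u2T] := andP uT2.
apply: contrapT => nog.
have gE s : 0 < s < T1 -> g1 s = g2 s.
  by move=> s0; apply: contrapT => gs; apply: nog; exists s.
rewrite -T12 in u2T k2 uT2.
have E1 := gE _ uT1; have E2 := gE _ uT2.
(* The loops are compared at the later of [u1] and [u2] for sliding, at the earlier for escaping:
   one is then strictly on its side and the other still on its own closed, opposite side. *)
case: b sl k1 k2 => _ k1 k2; have [u12|u12] := leP u1 u2.
- have := k1 u2; rewrite u12 ltW// => /(_ isT); rewrite E2; lra.
- have := k2 u1; rewrite (ltW u12) ltW// => /(_ isT); rewrite -E1; lra.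
- have := k2 u1; rewrite u12 ltW// => /(_ isT); rewrite -E1; lra.
- have := k1 u2; rewrite (ltW u12) ltW// => /(_ isT); rewrite E2; lra.
Qed.

End two_loops.

(** * Orbits coded by binary words *)

Section words.
Context (R : realType) (k r n : nat) (M : metricType R).
Context (S : closed_riemannian_surface k M) (Z : filippov_system r n S).
Context (b : bool) (i : 'I_n) (x : M) (sl : slide Z b i x).
Context (g : bool -> R -> M) (T : bool -> R).
Hypothesis gT : forall c, loop Z x (g c) (T c).

(** The first loop also supplies the past, and [g true] the future after the last letter. Prefixing
    a letter discards the past of the orbit of the remaining word. *)
Fixpoint word_orbit (w : seq bool) : R -> M :=
  if w is c :: w' then
    fun t => splice (fun u => g c (T c + u)) (word_orbit w') (- T c + t)
  else g true.

Lemma word_orbit0 w : word_orbit w 0 = x.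
Proof.
case: w => [|c w] /=; first by have [_ _ + _ _] := gT true.
have [_ T0 g0 _ _] := gT c.
by rewrite /splice addr0 oppr_lt0 T0 subrr g0.
Qed.

Lemma word_orbitP w : filippov_orbit Z (word_orbit w).
Proof.
elim: w => [|c w ow]; first by have [] := gT true.
have [og _ _ gTx _] := gT c.
apply: (@filippov_orbit_shift _ _ _ _ _ _ _ _
  (splice (fun u => g c (T c + u)) (word_orbit w))).
apply: (splice_orbit (b := b) (i := i)) => //.
- exact: filippov_orbit_shift.
- by rewrite addr0 gTx word_orbit0.
- by rewrite word_orbit0.
Qed.

Lemma word_orbit_lt c w t : t < T c -> word_orbit (c :: w) t = g c t.
Proof. by move=> tT; rewrite /= /splice addrC subr_lt0 tT subrKC. Qed.

Lemma word_orbit_ge c w t : word_orbit (c :: w) (T c + t) =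
  if t < 0 then g c (T c + t) else word_orbit w t.
Proof. by rewrite /= /splice addKr. Qed.

Lemma word_orbit_end c w : word_orbit (c :: w) (T c) = x.
Proof. by have := word_orbit_ge c w 0; rewrite addr0 ltxx word_orbit0. Qed.

(** At the first letter where two words differ, both orbits are at [x] at the
    same time. They separate at the end of the shorter loop if the loops have
    different periods. *)
Lemma word_orbit_separated :
  (T true = T false -> exists2 s, 0 < s < T true & g true s <> g false s) ->
  exists2 delta : R, 0 < delta & forall w w', size w = size w' -> w <> w' ->
    exists2 t, 0 <= t <= (size w)%:R * Num.max (T true) (T false) &
      delta <= mdist (word_orbit w t) (word_orbit w' t).
Proof.
move=> Teq; have [_ T10 g10 g1T n1] := gT true; have [_ T00 g00 g0T n0] := gT false.
have dist_pos (y z : M) : y <> z -> 0 < mdist y z.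
  move=> yz; rewrite lt_neqAle mdist_ge0 andbT eq_sym; apply/eqP => /mdist_positivity.
  exact: yz.
set m := Num.max _ _.
have Tm c : T c <= m by rewrite /m le_max; case: c; rewrite lexx ?orbT.
have Tc0 c : 0 < T c by case: c.
have [delta d0 sep] : exists2 delta : R, 0 < delta & forall w w',
    exists2 t, 0 <= t <= m & delta <= mdist (word_orbit (true :: w) t) (word_orbit (false :: w') t).
  have [T12|T12|T12] := ltgtP (T true) (T false).
  - exists (mdist x (g false (T true))).
      by apply/dist_pos/nesym/n0; rewrite T10.
    move=> w w'; exists (T true); first by rewrite (ltW (Tc0 _)) Tm.
    by rewrite (word_orbit_lt _ T12) word_orbit_end.
  - exists (mdist (g true (T false)) x).
      by apply/dist_pos/n1; rewrite T00.
    move=> w w'; exists (T false); first by rewrite (ltW (Tc0 _)) Tm.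
    by rewrite (word_orbit_lt _ T12) word_orbit_end.
  - have [s /andP[s0 sT] gs] := Teq T12.
    exists (mdist (g true s) (g false s)); first exact: dist_pos.
    move=> w w'; exists s; first by rewrite (ltW s0) (le_trans (ltW sT)).
    by rewrite !word_orbit_lt// -T12.
have m0 : 0 <= m by rewrite (le_trans _ (Tm true)) // ltW.
exists delta => // w; elim: w => [|c w IH] [|c' w'] // [sw] cw.
have [cc|cc] := eqVneq c c'.
  have [|t t0 tsep] := IH w' sw; first by move=> ww; apply: cw; rewrite cc ww.
  exists (T c + t); last first.
    by rewrite -cc !word_orbit_ge ltNge; case/andP: t0 => -> /=.
  case/andP: t0 => t0 tm; rewrite addr_ge0//=; last exact: ltW.
  by rewrite -natr1 mulrDl mul1r addrC lerD.
have m1 : m <= (size (c :: w))%:R * m.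
  by rewrite ler_peMl// ler1n.
case: c c' cc cw m1 => -[] // _ _ m1.
  by have [t /andP[t0 tm] st] := sep w w'; exists t; rewrite ?t0 ?(le_trans tm).
have [t /andP[t0 tm] st] := sep w' w.
by exists t; rewrite 1?metric_sym ?t0 ?(le_trans tm).
Qed.

End words.

(** * The theorem *)

Section flow.
Context (R : realType) (k r n : nat) (M : metricType R).
Context (S : closed_riemannian_surface k M) (Z : filippov_system r n S).

(** The shift moves the window of index [i] to [i + 1], and the two weights differ by a factor of at
    most 2; so the time-1 map is 2-Lipschitz. *)
Lemma dist_term_shift (c0 c1 : R -> M) (i : int) :
  dist_term (fun s => c0 (1 + s)) (fun s => c1 (1 + s)) i <= 2 * dist_term c0 c1 (i + 1).
Proof.
have cM : compact [set: M] := surface_compact S.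
have -> : dist_term (fun s => c0 (1 + s)) (fun s => c1 (1 + s)) i =
    2 ^- (absz i) * (2 ^+ (absz (i + 1)) * dist_term c0 c1 (i + 1)).
  rewrite /dist_term mulVKf ?expf_neq0//; congr (_ * sup _).
  apply/seteqP; split=> [_ [t /= it <-]|_ [t /= it <-]].
    exists (1 + t) => //=; rewrite [(i + 1 + 1)%:~R]rmorphD/= [(i + 1)%:~R]rmorphD/=.
    by move: it; rewrite rmorphD/=; lra.
  exists (t - 1) => /=; last by rewrite subrKC.
  by move: it; rewrite [(i + 1 + 1)%:~R]rmorphD/= [(i + 1)%:~R]rmorphD/=; lra.
rewrite mulrA; apply: ler_wpM2r; first exact: dist_term_ge0.
rewrite ler_pdivrMl ?exprn_gt0// -exprSr ler_weXn2l ?ler1n//; lia.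
Qed.

Lemma dist_sup_shift (c0 c1 : R -> M) :
  dist_sup (fun s => c0 (1 + s)) (fun s => c1 (1 + s)) <= 2 * dist_sup c0 c1.
Proof.
have cM : compact [set: M] := surface_compact S.
have ge0 i : (0 <= (dist_term c0 c1 i)%:E)%E by rewrite lee_fin dist_term_ge0.
rewrite -lee_fin mulr_natl mulr2n EFinD /dist_sup !fineK ?dist_sup_fin//.
have -> : (\esum_(i in [set: int]) (dist_term c0 c1 i)%:E =
    \esum_(i in [set: int]) (dist_term c0 c1 (i + 1))%:E)%E.
  apply: (reindex_esum setT setT (fun i => i + 1)).
  by split=> // [i j _ _ /addIr//|i _]; exists (i - 1) => //; exact: subrK.
rewrite -esumD//; apply: le_esum => i _.
by rewrite -EFinD lee_fin -mulr2n -mulr_natl dist_term_shift.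
Qed.

Lemma orbit_flow_continuous : continuous (@orbit_flow R k r n M S Z 1).
Proof.
move=> c U /nbhs_ballP[e /= e0 eU]; apply/nbhs_ballP.
exists (e / 2) => /=; first by rewrite divr_gt0.
move=> d; rewrite ballEmdist /= ltr_pdivlMr// mulrC => cd; apply: eU.
by rewrite ballEmdist /=; apply: le_lt_trans cd; exact: dist_sup_shift.
Qed.

Lemma iter_orbit_flow j (c : orbit_space Z) (s : R) :
  sval (iter j (orbit_flow 1) c) s = sval c (j%:R + s).
Proof.
elim: j s => [|j IH] s /=; first by rewrite add0r.
by rewrite IH addrA natr1.
Qed.
End flow.

Theorem theorem2p3 (R : realType) :
  exists k0 : nat, forall (k r n : nat) (M : metricType R)
      (S : closed_riemannian_surface k M) (Z : filippov_system r n S),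
    (k0 <= k)%N -> (1 <= r <= k)%N ->
    compact [set: orbit_space Z] ->
    transitive_system Z ->
    finite_set (\bigcup_i tangency Z i) ->
    (forall p, ~ pseudo_equilibrium Z p) ->
    \bigcup_i (sliding Z i `|` escaping Z i) !=set0 ->
    (0 < filippov_entropy Z)%E.
Proof.
exists 1%N => k r n M S Z k0 /andP[r0 _] cO tZ _ npe [x [i _ slx]].
have [b sl] : exists b, slide Z b i x.
  by case: slx => ?; [exists true|exists false].
have sf0 : sliding_field Z i x != 0.
  by apply/eqP => sf0; apply: (npe x); exists i.
have [g [T [gT Tneq]]] := two_loops k0 r0 cO tZ sl sf0.
have [delta d0 sep] := word_orbit_separated gT Tneq.
have cM : compact [set: M] := surface_compact S.
pose F w : orbit_space Z := exist _ _ (word_orbitP sl gT w).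
set m := Num.max (T true) (T false) in sep.
have m0 : 0 <= m by rewrite /m le_max; have [_ /ltW-> ] := gT true.
(* [(Num.truncn m).+1] is an integer above the longer period, hence above the time spent on a
   letter. *)
apply: (@topological_entropy_gt0 R _ _ cO (@orbit_flow_continuous R k r n M S Z)
  F delta (Num.truncn m).+1 d0) => w w' ww' neq.
have [t /andP[t0 tm] dt] := sep w w' ww' neq.
exists (Num.truncn t).
  rewrite -ltnS -(ltr_nat R); apply: le_lt_trans (_ : t < _).
    by rewrite truncn_le.
  apply: le_lt_trans tm _; rewrite -natr1 natrM ltr_pwDr//.
  by rewrite ler_wpM2l// ltW// truncnS_gt.
apply: le_trans dt _.
have /andP[h1 h2] := truncn_itv t0.
(* A separation at the real time [t] is seen at the integer time below it, as the term of index 0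
   covers the unit interval with weight 1. *)
have E v : word_orbit g T v t =
    sval (iter (Num.truncn t) (orbit_flow 1) (F v)) (t - (Num.truncn t)%:R).
  by rewrite iter_orbit_flow subrKC.
rewrite !E.
apply: le_trans (mdist_le_dist_sup (i := 0) _ _ cM _) _.
  by rewrite subr_ge0 h1 /= add0r ltrBlDl natr1 h2.
by rewrite expr0 mul1r.
Qed.
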